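(* Let $R_s$ define an explicit Runge--Kutta method of linear order $p\ge 1$ whose leading index satisfies $k^*=\lceil \frac{p+1}{2}\rceil$. Let $\beta_{k^*}$ and $\Gamma^*$ be its leading coefficient and leading submatrix. If $p$ is even, let $\mu_0$ be a real number such that the $k^*\times k^*$ matrix $\Gamma^*-\mathrm{diag}(0,\dots,0,\mu_0)$ is negative semidefinite (such a number exists). Suppose $\nu<\nu_0:=-\frac{\beta_{k^*}}{2}$ and 1. $\mu=0$ if $p$ is odd, 2. $\mu>\mu_0$ if $p$ is even. Then the corresponding modified method and the corresponding filtering method, with parameters $(\mu,\nu)$, are (linearly) $p$th order accurate and are strongly stable.
   Context: Setting. $(V,\langle\cdot,\cdot\rangle)$ is a real inner product space with norm $\|\cdot\|$ (also used for the induced operator norm). $L:V\to V$ is a bounded linear operator having an adjoint $L^\top$, and it is semi-negative: $\langle Lv,v\rangle\le 0$ for all $v\in V$. The problem is $\frac{d}{dt}u=Lu$. For a time step $\tau>0$ put $Z=\tau L$. Runge--Kutta method. One step from $u_0\in V$ gives $u_+=R_s(Z)u_0$, where $R_s(Z)=\sum_{k=0}^s\alpha_kZ^k$ has real coefficients with $\alpha_0=\alpha_1=1$ and $\alpha_s\neq0$ (set $\alpha_k=0$ for $k>s$). It has linear order $p$ if $\alpha_k=\frac1{k!}$ for all $k\le p$ and $\alpha_{p+1}\ne\frac{1}{(p+1)!}$. Energy coefficients. Let $[v,w]:=-\langle Zv,w\rangle-\langle v,Zw\rangle$, a semi-inner-product, with semi-norm $[v]:=\sqrt{[v,v]}$.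 Repeated use of $\langle Zv,w\rangle=-\langle v,Zw\rangle-[v,w]$ gives an identity $$\|u_+\|^2-\|u_0\|^2=\sum_{k=1}^s\beta_k\|Z^ku_0\|^2+\sum_{i,j=0}^{s-1}\gamma_{i,j}[Z^iu_0,Z^ju_0],\qquad \gamma_{i,j}=\gamma_{j,i},$$ with real coefficients $\beta_k,\gamma_{i,j}$ depending only on $\{\alpha_k\}$; equivalently, they are determined by the polynomial identity $R_s(x)R_s(y)-1=\sum_{k=1}^s\beta_k(xy)^k-(x+y)\sum_{i,j=0}^{s-1}\gamma_{i,j}x^iy^j$. The leading index $k^*$ is the smallest $k\ge1$ with $\beta_k\ne0$. The leading submatrix is $\Gamma^*=(\gamma_{i,j})_{0\le i,j\le k^*-1}$. Modified method with parameters $\mu,\nu\in\mathbb{R}$: $u_{\mathrm M}=R_s(\tilde Z)u_0$, where $\tilde Z=Z+\mu(Z^\top)^{k^*-1}Z^{k^*}+\nu(Z^\top)^{k^*}Z^{k^*}$. Filtering method with parameters $\mu,\nu\in\mathbb{R}$: $u_{\mathrm F}=\left(I+\mu(Z^\top)^{k^*-1}Z^{k^*}+\nu(Z^\top)^{k^*}Z^{k^*}\right)u_+$. Strong stability of a one-step method $u_0\mapsto u_\#$ (with $\#\in\{\mathrm M,\mathrm F\}$): there is a constant $\lambda>0$, depending only on $\{\alpha_k\},\mu,\nu$, such that $\|u_\#\|\le\|u_0\|$ for every real inner product space $(V,\langle\cdot,\cdot\rangle)$, every bounded linear operator $L:V\to V$ having an adjoint $L^\top$ and satisfying $\langle Lv,v\rangle\le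 0$ for all $v\in V$, all $u_0\in V$ and all $\tau>0$ with $\|Z\|=\tau\|L\|\le\lambda$. Linearly $p$th order accurate: for each fixed $L$, $u_0$ (and fixed $\mu,\nu$), the one-step error satisfies $\|u_\#-e^{\tau L}u_0\|=\mathcal O(\tau^{p+1})$ as $\tau\to0$. *)

(* Defs.v *)
From HB Require Import structures.
From mathcomp Require Import all_boot all_order all_algebra.
From mathcomp Require Import all_classical all_reals all_analysis.
Set Implicit Arguments.
Unset Strict Implicit.
Unset Printing Implicit Defensive.
Import Order.TTheory GRing.Theory Num.Theory.
Import numFieldNormedType.Exports.
Local Open Scope classical_set_scope.
Local Open Scope ring_scope.

Section RungeKutta.
Variable R : realType.

(* The stability polynomial R_s = \sum_(k <= s) alpha_k 'X^k is represented by
   P : {poly R}, with alpha_k = P`_k; in particular P`_k = 0 for k > s. *)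
Definition rk_polynomial (s : nat) (P : {poly R}) : Prop :=
  [/\ size P = s.+1, P`_0 = 1 & P`_1 = 1].

Definition linear_order (P : {poly R}) (p : nat) : Prop :=
  (forall k, (k <= p)%N -> P`_k = k`!%:R^-1) /\ P`_p.+1 != p.+1`!%:R^-1.

(* R_s(x) R_s(y) - 1 =
   \sum_k beta_k (xy)^k - (x + y) \sum_(i, j) gamma_(i, j) x^i y^j
   in R[y][x], where x is 'X and y is 'Y := 'X%:P.  The values of beta outside
   1..s and of gamma outside 0..s-1 are unconstrained and never used. *)
Definition energy_coefficients (s : nat) (P : {poly R})
    (beta : nat -> R) (gamma : nat -> nat -> R) : Prop :=
  (forall i j, (i < s)%N -> (j < s)%N -> gamma i j = gamma j i) /\
  P^:P * P%:P - 1 =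
    \sum_(1 <= k < s.+1) (beta k)%:P%:P * ('X * 'Y) ^+ k
    - ('X + 'Y) *
      \sum_(i < s) \sum_(j < s) (gamma i j)%:P%:P * ('X ^+ i * 'Y ^+ j)
    :> {poly {poly R}}.

Definition leading_index (s : nat) (beta : nat -> R) (k : nat) : Prop :=
  [/\ (1 <= k <= s)%N, beta k != 0 &
      forall j, (1 <= j < k)%N -> beta j = 0].

Definition leading_submatrix (gamma : nat -> nat -> R) (k : nat) : 'M[R]_k :=
  \matrix_(i < k, j < k) gamma i j.

(* diag(0, ..., 0, a) *)
Definition last_diag (k : nat) (a : R) : 'M[R]_k :=
  diag_mx (\row_(i < k) (if i.+1 == k then a else 0)).

Definition negative_semidefinite (n : nat) (A : 'M[R]_n) : Prop :=
  forall x : 'cV[R]_n, (x^T *m A *m x) 0 0 <= 0.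

Section Operators.
Variable V : normedModType R.

Definition poly_op (P : {poly R}) (Z : V -> V) (u : V) : V :=
  \sum_(k < size P) P`_k *: iter k Z u.

(* mu (Z^T)^(k-1) Z^k + nu (Z^T)^k Z^k, with Zt standing for Z^T *)
Definition correction (k : nat) (mu nu : R) (Z Zt : V -> V) (u : V) : V :=
  mu *: iter k.-1 Zt (iter k Z u) + nu *: iter k Zt (iter k Z u).

Definition opnorm (L : V -> V) : R :=
  sup [set `|L v| | v in [set v : V | `|v| <= 1]].

(* V is an inner product space: its norm is the one induced by ip. *)
Definition induced_norm (ip : {dot V for idfun}) : Prop :=
  forall v : V, `|v| = Num.sqrt (ip v v).

Definition adjoint (ip : {dot V for idfun}) (L Lt : V -> V) : Prop :=
  forall v w : V, ip (L v) w = ip v (Lt w).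

Definition semi_negative (ip : {dot V for idfun}) (L : V -> V) : Prop :=
  forall v : V, ip (L v) v <= 0.

Definition admissible (ip : {dot V for idfun}) (L Lt : {linear V -> V}) : Prop :=
  [/\ induced_norm ip, bounded_fun_norm L, adjoint ip L Lt & semi_negative ip L].

(* V need not be complete, so e^Z u is taken in a complete space W into which
   V embeds isometrically by iota (iota = id when V is complete). *)
Definition exp_op (W : completeNormedModType R) (iota : V -> W)
    (Z : V -> V) (u : V) : W :=
  limn (series (fun k => iota (k`!%:R^-1 *: iter k Z u))).

End Operators.

(* A one-step method maps (Z, Z^T, u_0) to the next value, uniformly in V. *)
Definition method := forall V : normedModType R, (V -> V) -> (V -> V) -> V -> V.

Definition modified_method (P : {poly R}) (k : nat) (mu nu : R) : method :=
  fun V Z Zt u => poly_op P (fun v => Z v + correction k mu nu Z Zt v) u.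

Definition filtering_method (P : {poly R}) (k : nat) (mu nu : R) : method :=
  fun V Z Zt u =>
    let up := poly_op P Z u in up + correction k mu nu Z Zt up.

Definition strongly_stable (step : method) : Prop :=
  exists2 lambda : R, 0 < lambda &
    forall (V : normedModType R) (ip : {dot V for idfun})
      (L Lt : {linear V -> V}),
      admissible ip L Lt ->
      forall (u0 : V) (tau : R), 0 < tau -> opnorm (tau \*: L) <= lambda ->
        `|step V (tau \*: L) (tau \*: Lt) u0| <= `|u0|.

Definition linearly_accurate (p : nat) (step : method) : Prop :=
  forall (V : normedModType R) (ip : {dot V for idfun})
    (L Lt : {linear V -> V}),
    admissible ip L Lt ->
    forall (W : completeNormedModType R) (iota : {linear V -> W}),
      (forall v, `|iota v| = `|v|) ->
      forall u0 : V,
        (fun tau : R => iota (step V (tau \*: L) (tau \*: Lt) u0)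
                        - exp_op iota (tau \*: L) u0)
        =O_ (0^'+) (fun tau : R => tau ^+ p.+1 : R^o).

End RungeKutta.

(* Main.v *)
Require Import Defs.
From HB Require Import structures.
From mathcomp Require Import all_boot all_order all_algebra.
From mathcomp Require Import all_classical all_reals all_analysis.
From mathcomp Require Import ring lra zify.
Import Order.TTheory GRing.Theory Num.Theory.
Import numFieldNormedType.Exports.
Local Open Scope classical_set_scope.
Local Open Scope ring_scope.
Set Implicit Arguments.
Unset Strict Implicit.
Unset Printing Implicit Defensive.

(** Put S = - (Z + Z^T), so that [v, w] = <Sv, w> is a semi-inner product, and
    measure a state u by its dissipation

      E(u) = sum_(i < k) [Z^i u, Z^i u] + |Z^k u|^2.

    In one step, each method changes the energy |u|^2 by a quadratic form
    <u, F u>, where F is a combination of words in the letters Z and Z^T.  Strong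
    stability follows once this change is at most - c E(u) plus an error that is
    a small multiple of E(u) when |Z| is small; c and the error must depend on
    the coefficients and parameters of the method only.

    Long words are errors.  Since Z^T = - Z - S and |Sv|^2 <= 2 |Z| [v, v], the
    letters Z^T of a word can be traded for Z at the price of terms controlled
    by the [Z^i u, Z^i u]; hence a word of length at least k maps u to a vector
    of squared norm O(E(u)), with a further factor |Z|^2 per extra letter
    (word_op_dissipation, word_op_split).  Splitting a word in two shows
    that forms <u, F u> whose words have more than 2k letters are errors
    (absorbable_form), and so are the [F u, Z^i u] with F of length at least k
    (absorbable_bracket).

    What remains are words of length at most 2k.  The energy identity of the
    Runge--Kutta step leaves beta_k |Z^k u|^2 plus the form of Gamma* in the
    Z^i u (runge_kutta_balance).  The correction, whose words have length 2k-1
    and 2k, adds - mu [Z^(k-1) u, Z^(k-1) u] + 2 nu |Z^k u|^2 exactly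
    (corr_op_energy); its products with one more letter Z have length 2k when
    mu is nonzero, but they cancel up to errors.  For the filtering method this
    is skew-symmetry of Z modulo S; for the modified method it also takes
    alpha_2 = 1/2, which holds because mu is nonzero only for even p.

    The leading form is coercive.  The order conditions force
    gamma_ij = - 1 / (i! j! (i+j+1)) for i + j < p (gamma_low), a rescaled
    Hilbert matrix; this covers Gamma* entirely when p is odd, and all but its
    last diagonal entry when p is even, which is what mu repairs.
    Symmetric elimination turns positive definiteness of a scalar matrix into
    coercivity for every semi-inner product at once, with a single constant
    (pos_def_coercive).

    Accuracy is again a matter of counting letters: the correction
    consists of words of length at least p+1, so both methods agree with the
    Taylor polynomial of degree p of exp(Z) up to words of that length. *)

(** * Coercivity of positive definite matrices *)

Section SemiInner.
Variable R : realType.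

Record semi_inner {V : lmodType R} (B : V -> V -> R) : Prop := SemiInner {
  siC : forall u v, B u v = B v u;
  siDl : forall u v w, B (u + v) w = B u w + B v w;
  siZl : forall a u v, B (a *: u) v = a * B u v;
  si_ge0 : forall u, 0 <= B u u }.

Section Theory.
Variables (V : lmodType R) (B : V -> V -> R).
Hypothesis hB : semi_inner B.

Lemma siDr u v w : B u (v + w) = B u v + B u w.
Proof. by rewrite (siC hB) (siDl hB) !(siC hB u). Qed.

Lemma siZr a u v : B u (a *: v) = a * B u v.
Proof. by rewrite (siC hB) (siZl hB) (siC hB u). Qed.

Lemma siNl u v : B (- u) v = - B u v.
Proof. by rewrite -scaleN1r (siZl hB) mulN1r. Qed.

Lemma siNr u v : B u (- v) = - B u v.
Proof. by rewrite (siC hB) siNl (siC hB u). Qed.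

Lemma si0l u : B 0 u = 0.
Proof. by rewrite -(scale0r 0) (siZl hB) mul0r. Qed.

Lemma si0r u : B u 0 = 0.
Proof. by rewrite (siC hB) si0l. Qed.

Lemma si_suml I (r : seq I) (P : pred I) (f : I -> V) v :
  B (\sum_(i <- r | P i) f i) v = \sum_(i <- r | P i) B (f i) v.
Proof.
exact: (big_morph (B ^~ v) (fun x y => siDl hB x y v) (si0l v)).
Qed.

Lemma si_sumr I (r : seq I) (P : pred I) (f : I -> V) v :
  B v (\sum_(i <- r | P i) f i) = \sum_(i <- r | P i) B v (f i).
Proof. exact: (big_morph (B v) (fun x y => siDr v x y) (si0r v)). Qed.

(** Weighted arithmetic-geometric mean inequality: it replaces Cauchy-Schwarz
    below, the weight being chosen to balance the powers of |Z|. *)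
Lemma si_amgm (c : R) u v : 0 < c -> 2 * `|B u v| <= c * B u u + c^-1 * B v v.
Proof.
move=> c0.
have key s : s ^+ 2 = 1 -> s * B u v * 2 <= c * B u u + c^-1 * B v v.
  move=> s1; have := si_ge0 hB (c *: u - s *: v).
  have -> : B (c *: u - s *: v) (c *: u - s *: v) =
      c * (c * B u u + c^-1 * (s ^+ 2 * B v v) - s * B u v * 2).
    rewrite !(siDl hB) !siDr !siNl !siNr !(siZl hB) !siZr (siC hB v u).
    by field; exact: lt0r_neq0.
  by rewrite s1 mul1r pmulr_rge0 // subr_ge0.
have [h|h] := ger0P (B u v).
  by have := key 1 (expr1n _ _); lra.
by have := key (-1); rewrite sqrrN expr1n => /(_ erefl); lra.
Qed.

Lemma si_sqrD u v : B (u + v) (u + v) <= 2 * B u u + 2 * B v v.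
Proof.
have := si_ge0 hB (u - v).
rewrite !(siDl hB) !siDr !siNl !siNr (siC hB v u); lra.
Qed.

End Theory.

Lemma si_sum_bound n (t : nat -> R) : exists2 K : R, 0 <= K &
  forall (V : lmodType R) (B : V -> V -> R), semi_inner B ->
  forall f : nat -> V,
  let w := \sum_(i < n) t i *: f i in
  B w w <= K * \sum_(i < n) B (f i) (f i).
Proof.
elim: n => [|n [K K0 IH]].
  by exists 0 => // V B hB f; rewrite /= !big_ord0 mul0r (si0l hB).
exists (2 * K + 2 * t n ^+ 2) => [|V B hB f /=].
  by apply: addr_ge0; apply: mulr_ge0 => //; apply: sqr_ge0.
rewrite !big_ord_recr /=; apply: le_trans (si_sqrD hB _ _) _.
rewrite (siZl hB) (siZr hB) mulrDr !mulrDl.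
have h := IH V B hB f; have b0 := si_ge0 hB (f n).
have s0 : 0 <= \sum_(i < n) B (f i) (f i).
  by apply: sumr_ge0 => i _; apply: (si_ge0 hB).
have t0 := sqr_ge0 (t n).
have ts := mulr_ge0 t0 s0; have Kb := mulr_ge0 K0 b0.
rewrite /= in h; rewrite !expr2 in ts *; lra.
Qed.

(** The quadratic form of the matrix N evaluated at vectors instead of scalars:
    it is the trace of N times the Gram matrix of the v i. *)
Definition gram_form {V : lmodType R} n (N : nat -> nat -> R) (B : V -> V -> R)
    (v : nat -> V) : R := \sum_(i < n) \sum_(j < n) N i j * B (v i) (v j).

(** Schur complement of the last diagonal entry: what is left of the form after
    completing the square in the last variable. *)
Definition schur_complement n (N : nat -> nat -> R) i j :=
  N i j - N i n * N j n / N n n.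

Definition scalar_ip (x y : R^o) : R := x * y.

Lemma scalar_semi_inner : semi_inner scalar_ip.
Proof.
split=> [u v|u v w|a u v|u].
- exact: mulrC.
- exact: mulrDl.
- by rewrite /scalar_ip /GRing.scale /= mulrA.
- by rewrite /scalar_ip -expr2 sqr_ge0.
Qed.

Definition pos_def n (N : nat -> nat -> R) : Prop :=
  forall x : nat -> R, (exists2 i, (i < n)%N & x i != 0) ->
  0 < gram_form n N scalar_ip x.

Lemma gram_form_recr (V : lmodType R) (B : V -> V -> R) (hB : semi_inner B) n N v :
  (forall i j, (i <= n)%N -> (j <= n)%N -> N i j = N j i) ->
  gram_form n.+1 N B v = gram_form n N B v + 2 * (\sum_(i < n) N i n * B (v i) (v n))
    + N n n * B (v n) (v n).
Proof.
move=> hN; rewrite /gram_form big_ord_recr /= big_ord_recr /=.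
under eq_bigr do rewrite big_ord_recr /=.
rewrite big_split /=.
have -> : \sum_(i < n) N n i * B (v n) (v i) = \sum_(i < n) N i n * B (v i) (v n).
  by apply: eq_bigr => i _; rewrite hN ?(siC hB (v n)) // ltnW.
ring.
Qed.

Lemma gram_form_schur (V : lmodType R) (B : V -> V -> R) (hB : semi_inner B) n N v :
  (forall i j, (i <= n)%N -> (j <= n)%N -> N i j = N j i) -> N n n != 0 ->
  let w := v n + \sum_(i < n) (N i n / N n n) *: v i in
  gram_form n.+1 N B v = N n n * B w w + gram_form n (schur_complement n N) B v.
Proof.
move=> hN N0 w; rewrite gram_form_recr //.
pose r := \sum_(i < n) (N i n / N n n) *: v i.
have e1 : \sum_(i < n) N i n * B (v i) (v n) = N n n * B r (v n).
  rewrite (si_suml hB) mulr_sumr; apply: eq_bigr => i _.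
  by rewrite (siZl hB); field.
have e2 : gram_form n (schur_complement n N) B v = gram_form n N B v - N n n * B r r.
  rewrite (si_suml hB) mulr_sumr /gram_form -sumrB; apply: eq_bigr => i _.
  rewrite (si_sumr hB) mulr_sumr -sumrB; apply: eq_bigr => j _.
  by rewrite (siZl hB) (siZr hB) /schur_complement; field.
have -> : B w w = B (v n) (v n) + 2 * B r (v n) + B r r.
  by rewrite /w -/r (siDl hB) !(siDr hB) (siC hB (v n) r); ring.
by rewrite e1 e2; ring.
Qed.

(** Completing the square: for given x 0, ..., x n-1, choosing the last variable
    to annihilate the square leaves exactly the form of the complement. *)
Lemma pos_def_schur n N :
  (forall i j, (i <= n)%N -> (j <= n)%N -> N i j = N j i) ->
  pos_def n.+1 N -> 0 < N n n /\ pos_def n (schur_complement n N).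
Proof.
move=> hN hpd.
have Nn : 0 < N n n.
  have := hpd (fun i => (i == n)%:R).
  rewrite (gram_form_recr scalar_semi_inner) // /gram_form /scalar_ip eqxx !mulr1.
  rewrite big1 => [|i _]; last first.
    by apply: big1 => j _; rewrite (ltn_eqF (ltn_ord i)) !mul0r mulr0.
  rewrite big1 => [|i _]; last by rewrite (ltn_eqF (ltn_ord i)) mul0r mulr0.
  by rewrite mulr0 !add0r; apply; exists n; rewrite ?eqxx ?oner_eq0.
split=> // x [i0 i0n xi0].
(* The last variable is the one that cancels the completed square. *)
pose y i := if (i < n)%N then x i else
  - \sum_(j < n) (N j n / N n n) * x j.
have := hpd y; rewrite (gram_form_schur scalar_semi_inner) ?lt0r_neq0 //.
rewrite [y n]/y ltnn.
set t := - _ + \sum_(i < n) _.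
have -> : t = 0.
  rewrite /t -sumrN -big_split big1 //= => j _.
  by rewrite /y ltn_ord; apply: addNr.
rewrite {1}/scalar_ip mul0r mulr0 add0r.
have -> : gram_form n (schur_complement n N) scalar_ip y =
          gram_form n (schur_complement n N) scalar_ip x.
  apply: eq_bigr => i _; apply: eq_bigr => j _.
  by rewrite /y !ltn_ord.
by apply; exists i0; [exact: ltnW | rewrite /y i0n].
Qed.

(** The square completion holds verbatim for vectors, so eliminating one variable
    at a time reduces every semi-inner product to the same sum of squares; the
    constant c only sees the entries of N. *)
Lemma pos_def_coercive n N :
  (forall i j, (i < n)%N -> (j < n)%N -> N i j = N j i) -> pos_def n N ->
  exists2 c : R, 0 < c & forall (V : lmodType R) (B : V -> V -> R), semi_inner B ->
  forall v : nat -> V, c * \sum_(i < n) B (v i) (v i) <= gram_form n N B v.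
Proof.
elim: n N => [|n IH] N hN hpd.
  by exists 1 => // V B hB v; rewrite /gram_form !big_ord0 mulr0.
have [Nn hS] := pos_def_schur hN hpd.
have hNS i j : (i < n)%N -> (j < n)%N ->
    schur_complement n N i j = schur_complement n N j i.
  by move=> hi hj; rewrite /schur_complement (hN i j (leqW hi) (leqW hj)); ring.
have [c c0 hc] := IH _ hNS hS.
have [K K0 hK] := si_sum_bound n (fun i => N i n / N n n).
(* The square of v n is at most twice that of the completed variable plus
   2 K times the sum of the others. *)
pose d := Num.min (N n n / 2) (c / (2 * K + 1)).
have d0 : 0 < d.
  by rewrite lt_min !divr_gt0 // ltr_wpDl // mulr_ge0.
exists d => // V B hB v.
rewrite (gram_form_schur hB) ?lt0r_neq0 //= big_ord_recr /=.
set r := \sum_(i < n) (N i n / N n n) *: v i.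
have h1 := hc V B hB v.
have h2 := hK V B hB v; rewrite /= -/r in h2.
have h3 := si_sqrD hB (v n + r) (- r).
rewrite addrK (siNl hB) (siNr hB) opprK in h3.
set S := \sum_(i < n) _ in h1 h2 *.
have S0 : 0 <= S by apply: sumr_ge0 => i _; apply: (si_ge0 hB).
have w0 := si_ge0 hB (v n + r).
have d1 : d * 2 <= N n n by rewrite -ler_pdivlMr // ge_min lexx.
have d2 : d * (2 * K + 1) <= c.
  by rewrite -ler_pdivlMr ?ge_min ?lexx ?orbT // ltr_wpDl // mulr_ge0.
have h4 : d * B (v n) (v n) <= d * (2 * B (v n + r) (v n + r) + 2 * (K * S)).
  by rewrite ler_pM2l //; lra.
have h5 := ler_wpM2r w0 d1.
have h6 := ler_wpM2r S0 d2.
lra.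
Qed.

(** The Schur complement of a Cauchy matrix is again a Cauchy matrix up to
    diagonal scaling: 1/(i+j+1) - (2n+1)/((i+n+1)(j+n+1)) equals
    d_i d_j / (i+j+1) with d_i = (i-n)/(i+n+1), and d_i is nonzero for i < n. *)
Lemma hilbert_pos_def n : pos_def n (fun i j => (i + j).+1%:R^-1).
Proof.
suff: forall y : nat -> R, (exists2 i, (i < n)%N & y i != 0) ->
  0 < \sum_(i < n) \sum_(j < n) y i * y j / (i + j).+1%:R.
  move=> h x /h; congr (_ < _); apply: eq_bigr => i _; apply: eq_bigr => j _.
  by rewrite mulrC.
elim: n => [|n IH] y [i]; first by rewrite ltn0.
move=> hi yi.
pose N i j : R := (i + j).+1%:R^-1.
pose z j : R := (j%:R - n%:R) / (j + n).+1%:R * y j.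
have -> : \sum_(i < n.+1) \sum_(j < n.+1) y i * y j / (i + j).+1%:R =
   gram_form n.+1 N scalar_ip y.
  by apply: eq_bigr => i' _; apply: eq_bigr => j _; rewrite mulrC.
rewrite (gram_form_schur scalar_semi_inner); last 2 first.
- by move=> i' j _ _; rewrite /N addnC.
- by rewrite /N invr_eq0 pnatr_eq0.
set w := (X in scalar_ip X X).
have -> : gram_form n (schur_complement n N) scalar_ip y =
    \sum_(i < n) \sum_(j < n) z i * z j / (i + j).+1%:R.
  apply: eq_bigr => i' _; apply: eq_bigr => j _.
  rewrite /scalar_ip /schur_complement /N /z -!natr1 !natrD.
  have h (a b : nat) : a%:R + b%:R + 1 != 0 :> R by rewrite -natrD natr1 pnatr_eq0.
  by field; rewrite ?h.
have [/existsP [j yj]|hy] := boolP [exists j : 'I_n, y j != 0].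
  apply: ltr_wpDl; first by rewrite mulr_ge0 ?(si_ge0 scalar_semi_inner) // /N invr_ge0.
  apply: IH; exists j => //; rewrite /z; apply: mulf_neq0 => //.
  by rewrite mulf_neq0 ?invr_eq0 ?pnatr_eq0 // subr_eq0 eqr_nat (ltn_eqF (ltn_ord j)).
have y0 (j : 'I_n) : y j = 0.
  by move: hy; rewrite negb_exists => /forallP/(_ j); rewrite negbK => /eqP.
rewrite big1 => [|j _]; last by apply: big1 => j' _; rewrite /z y0 mulr0 !mul0r.
rewrite addr0 /w big1 => [|j _]; last by rewrite y0 scaler0.
have -> : n = i.
  move: hi; rewrite ltnS leq_eqVlt => /orP[/eqP//|hi].
  by have := y0 (Ordinal hi) => /= h; rewrite h eqxx in yi.
by rewrite addr0 /scalar_ip mulr_gt0 ?invr_gt0 ?ltr0Sn // -expr2 exprn_even_gt0.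
Qed.

End SemiInner.

(** * Energy coefficients of a Runge--Kutta method *)

Section EnergyCoefficients.
Variable R : realType.
Variables (s p k : nat) (P : {poly R}).
Variables (beta : nat -> R) (gamma : nat -> nat -> R).
Hypothesis hP : rk_polynomial s P.
Hypothesis hE : energy_coefficients s P beta gamma.

(** Extension by zero outside the ranges in which the energy coefficients are
    meaningful, so that coefficients can be compared in every degree. *)
Definition beta_ext a := if (1 <= a <= s)%N then beta a else 0.
Definition gamma_ext a b := if (a < s)%N && (b < s)%N then gamma a b else 0.

Lemma sum_indicator n (f : nat -> R) (a : nat) :
  \sum_(i < n) f i *+ (a == i)%N = if (a < n)%N then f a else 0.
Proof.
case: ltnP => an; last first.
  by apply: big1 => i _; rewrite gtn_eqF // (leq_trans _ an).
rewrite (bigD1 (Ordinal an)) //= eqxx big1 ?addr0 // => i ia.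
by rewrite (_ : (a == i) = false) //; apply: contra_neqF ia => /eqP ai; exact: val_inj.
Qed.

(** Coefficient of x^a y^b in the energy identity; the factor x + y shifts one of
    the two indices of gamma. *)
Lemma energy_coef a b : P`_a * P`_b - ((a == 0) && (b == 0))%:R =
  (if a == b then beta_ext a else 0)
  - ((if a is a'.+1 then gamma_ext a' b else 0)
     + (if b is b'.+1 then gamma_ext a b' else 0)).
Proof.
have [_] := hE => /(congr1 (fun Q : {poly {poly R}} => Q`_a`_b)).
rewrite !coefB coefMC coef_map coefCM coef1.
have -> : ((a == 0)%:R : {poly R})`_b = ((a == 0) && (b == 0))%:R.
  by case: (a == 0); rewrite /= ?coef1 ?coef0.
move=> ->.
pose S : {poly {poly R}} :=
  \sum_(i < s) \sum_(j < s) (gamma i j)%:P%:P * ('X ^+ i * 'Y ^+ j).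
have hS c d : S`_c`_d = gamma_ext c d.
  rewrite /S coef_sum coef_sum.
  transitivity (\sum_(i < s) (\sum_(j < s) gamma i j *+ (d == j)%N) *+ (c == i)%N).
    apply: eq_bigr => i _; rewrite coef_sum coef_sum -sumrMnl.
    apply: eq_bigr => j _.
    rewrite coefCM -polyC_exp coefMC coefXn coefCM.
    by case: (c == i); rewrite ?mul1r ?mul0r ?coef0 ?mulr0 // coefXn mulr_natr mulr1n.
  rewrite (sum_indicator s (fun i => \sum_(j < s) gamma i j *+ (d == j)%N)).
  by rewrite /gamma_ext; case: ltnP => //= _; rewrite (sum_indicator s (gamma c)).
congr (_ - _).
  rewrite !coef_sum.
  transitivity (\sum_(1 <= k0 < s.+1) (beta k0 *+ (b == k0)%N) *+ (a == k0)%N).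
    apply: eq_bigr => i _.
    rewrite exprMn -polyC_exp coefCM coefMC coefXn coefCM.
    by case: (a == i); rewrite ?mul1r ?mul0r ?coef0 ?mulr0 // coefXn mulr_natr mulr1n.
  transitivity (\sum_(i < s.+1) ((if a == b then beta_ext a else 0) *+
    (a == i)%N)); last first.
    rewrite (sum_indicator s.+1 (fun _ => if a == b then beta_ext a else 0)).
    case: ltnP => //; rewrite /beta_ext [(a <= s)%N]leqNgt => ->.
    by rewrite andbF if_same.
  rewrite big_ord_recl big_add1 big_mkord /=.
  rewrite [X in _ = X + _](_ : _ = 0) ?add0r.
    apply: eq_bigr => i _; rewrite /bump /=.
    have [->|//] := eqVneq a (1 + i)%N.
    by rewrite /beta_ext eq_sym add1n ltn_ord /=; case: eqP.
  by case: a => [|//]; rewrite /beta_ext /= if_same.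
rewrite -/S mulrDl !coefD coefXM coefCM coefXM.
by case: a => [|a]; case: b => [|b] /=; rewrite ?coef0 ?hS.
Qed.

Hypothesis hord : linear_order P p.
Hypothesis hk : leading_index s beta k.
Hypothesis hkp : k = uphalf p.+1.

Lemma order_le_stages : (p <= s)%N.
Proof.
have [sz _ _] := hP; have [h _] := hord.
have : P`_p != 0 by rewrite h // invr_eq0 pnatr_eq0 -lt0n fact_gt0.
by apply: contraNT; rewrite -ltnNge => sp; rewrite nth_default ?sz.
Qed.

(** Below degree p the polynomial is that of the exponential, for which
    exp(x + y) - 1 = (x + y) sum_m (x + y)^m / (m+1)! gives these values.  In
    coefficients: since 2a <= p forces a < k, the beta terms vanish and the
    remaining two-term recursion determines gamma row by row. *)
Lemma gamma_low i j : (i + j < p)%N ->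
  gamma i j = - (i`!%:R * j`!%:R * (i + j).+1%:R)^-1.
Proof.
have [hPf _] := hord; have ps := order_le_stages.
have [ks _ hb] := hk.
have fn0 m : m`!%:R != 0 :> R by rewrite pnatr_eq0 -lt0n fact_gt0.
have sn0 m : m%:R + 1 != 0 :> R by rewrite natr1 pnatr_eq0.
have sn0' (a b : nat) : a%:R + b%:R + 1 != 0 :> R by rewrite -natrD natr1 pnatr_eq0.
have gE a b : (a + b < p)%N -> gamma_ext a b = gamma a b.
  by move=> h; rewrite /gamma_ext !ifT //; lia.
elim: i j => [|i IH] j hij.
  have := energy_coef 0 j.+1; rewrite eqxx /= gE // !hPf; last 2 first.
  - lia.
  - lia.
  rewrite factS natrM fact0 add0n invr1 !mul1r [j`!%:R * _]mulrC => e.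
  have -> : gamma 0 j = - (0 - (0 + gamma 0 j)) by ring.
  by rewrite -e subr0.
have := energy_coef i.+1 j.+1; rewrite /= subr0 !gE; try lia.
rewrite IH; last lia.
rewrite !hPf; try lia.
have -> : (if i.+1 == j.+1 then beta_ext i.+1 else 0) = 0.
  case: eqP => // e; rewrite /beta_ext; case: ifP => // _.
  by apply: hb; rewrite hkp; lia.
rewrite add0r; set t := - _^-1 => e.
have -> : gamma i.+1 j = - (- (t + gamma i.+1 j)) - t by ring.
rewrite -e /t.
rewrite !addSn !addnS !factS !natrM -!natr1 !natrD.
have sn2 : i%:R + j%:R + 1 + 1 != 0 :> R by rewrite -natrD !natr1 pnatr_eq0.
by field; rewrite !fn0 !sn0 sn2.
Qed.

Lemma pos_def_gamma n : (n + n <= p.+1)%N -> pos_def n (fun i j => - gamma i j).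
Proof.
move=> np x [i hi xi].
have := @hilbert_pos_def R n (fun j => x j / j`!%:R).
have fn0 m : m`!%:R != 0 :> R by rewrite pnatr_eq0 -lt0n fact_gt0.
rewrite (_ : gram_form _ _ _ _ = gram_form n (fun i j => - gamma i j) (@scalar_ip R) x).
  by apply; exists i; rewrite // mulf_neq0 ?invr_eq0.
apply: eq_bigr => a _; apply: eq_bigr => b _.
rewrite gamma_low; last by have := ltn_ord a; have := ltn_ord b; lia.
rewrite /scalar_ip opprK !invfM; ring.
Qed.

(** The opposite of Gamma* - diag(0, ..., 0, m). *)
Definition shifted_gamma (m : R) i j : R :=
  (if (i.+1 == k) && (j.+1 == k) then m else 0) - gamma i j.

Lemma nsd_form m :
  negative_semidefinite (leading_submatrix gamma k - last_diag k m) <->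
  forall x : nat -> R, 0 <= gram_form k (shifted_gamma m) (@scalar_ip R) x.
Proof.
have key (x : nat -> R) (y : 'cV[R]_k) : (forall i : 'I_k, y i 0 = x i) ->
    (y^T *m (leading_submatrix gamma k - last_diag k m) *m y) 0 0 =
    - gram_form k (shifted_gamma m) (@scalar_ip R) x.
  move=> xy; rewrite mxE /gram_form exchange_big -sumrN /=; apply: eq_bigr => j _.
  rewrite !mxE mulr_suml -sumrN; apply: eq_bigr => i _.
  rewrite !mxE !xy /shifted_gamma /scalar_ip.
  have [->|ij] := eqVneq i j.
    by rewrite andbb /=; case: eqP => _; rewrite ?mulr1n; ring.
  rewrite mulr0n ifN; first by ring.
  apply: contra_neqN ij => /andP[/eqP ik /eqP jk].
  by apply/val_inj/succn_inj; rewrite ik jk.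
split=> h x; last first.
  rewrite (key (fun i => if insub i is Some i' then x i' 0 else 0)) ?oppr_le0 //.
  by move=> i; rewrite valK.
by have := h (\col_i x i); rewrite (key x) ?oppr_le0 // => i; rewrite mxE.
Qed.

Lemma gamma_sym i j : (i < k)%N -> (j < k)%N -> gamma i j = gamma j i.
Proof.
have [/andP[_ ks] _ _] := hk; have [h _] := hE.
by move=> ik jk; apply: h; apply: leq_trans ks.
Qed.

Lemma shifted_gamma_sym m i j : (i < k)%N -> (j < k)%N ->
  shifted_gamma m i j = shifted_gamma m j i.
Proof. by move=> ik jk; rewrite /shifted_gamma gamma_sym // andbC. Qed.

(** The shift is felt by the last diagonal entry only, so that the form of the
    first k-1 rows and columns keeps its definiteness whatever m is. *)
Lemma gram_form_shifted_recr m (V : lmodType R) (B : V -> V -> R) v :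
  semi_inner B -> let n := k.-1 in
  gram_form k (shifted_gamma m) B v = gram_form n (fun i j => - gamma i j) B v
    - 2 * (\sum_(i < n) gamma i n * B (v i) (v n))
    + (m - gamma n n) * B (v n) (v n).
Proof.
move=> hB n; have kn : k = n.+1 by rewrite /n hkp.
rewrite {1}kn (gram_form_recr hB) => [|i j hi hj]; last by rewrite shifted_gamma_sym // kn.
rewrite /shifted_gamma -kn eqxx /= -mulrN -sumrN.
congr (_ + 2 * _ + _).
  apply: eq_bigr => i _; apply: eq_bigr => j _.
  by rewrite ifF ?add0r //; have := ltn_ord i; lia.
apply: eq_bigr => i _.
by rewrite ifF ?add0r ?mulNr //; have := ltn_ord i; lia.
Qed.

Lemma gram_form_shifted m (V : lmodType R) (B : V -> V -> R) v :
  gram_form k (shifted_gamma m) B v =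
  m * B (v k.-1) (v k.-1) - gram_form k gamma B v.
Proof.
have kn : k = k.-1.+1 by rewrite hkp.
pose i0 : 'I_k := Ordinal (eq_leq (esym kn)).
have e (i : 'I_k) : (i.+1 == k) = (i == i0).
  by rewrite -val_eqE /= -[in RHS]eqSS -kn.
rewrite /gram_form.
have -> : m * B (v k.-1) (v k.-1) = \sum_(i < k) \sum_(j < k)
    (if (i == i0) && (j == i0) then m else 0) * B (v i) (v j).
  rewrite (bigD1 i0) //= (bigD1 i0) //= eqxx big1 => [|j /negbTE ->]; last first.
    by rewrite mul0r.
  rewrite addr0 big1 ?addr0 // => i /negbTE ->.
  by apply: big1 => j _; rewrite mul0r.
rewrite -sumrB; apply: eq_bigr => i _; rewrite -sumrB; apply: eq_bigr => j _.
by rewrite /shifted_gamma !e mulrBl.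
Qed.

(** With c the coercivity constant of the first k-1 rows and columns, the square
    of c x_i - gamma_(i, k-1) x_(k-1) absorbs each mixed term; its cost is a
    multiple of x_(k-1)^2, which m is chosen to cover. *)
Lemma exists_nsd_shift : ~~ odd p -> exists m : R,
  negative_semidefinite (leading_submatrix gamma k - last_diag k m).
Proof.
move=> pe; set n := k.-1; have kn : k = n.+1 by rewrite /n hkp.
have npd : pos_def n (fun i j => - gamma i j).
  by apply: pos_def_gamma; move: kn; rewrite hkp; lia.
have nsym i j : (i < n)%N -> (j < n)%N -> - gamma i j = - gamma j i.
  by move=> hi hj; rewrite gamma_sym // kn ltnW.
have [c c0 hc] := pos_def_coercive nsym npd.
(* The first summand cancels the last diagonal entry of - Gamma*. *)
exists (gamma n n + \sum_(i < n) gamma i n ^+ 2 / c).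
apply/nsd_form => x; set m := _ + _.
have := hc _ _ (scalar_semi_inner R) x.
rewrite (gram_form_shifted_recr _ _ (scalar_semi_inner R)) -/n => h.
have h2 : 0 <= \sum_(i < n) (c * scalar_ip (x i) (x i)
    - 2 * (gamma i n * scalar_ip (x i) (x n))
    + gamma i n ^+ 2 / c * scalar_ip (x n) (x n)).
  apply: sumr_ge0 => i _.
  rewrite /scalar_ip (_ : _ + _ = c^-1 * (c * x i - gamma i n * x n) ^+ 2).
    by rewrite mulr_ge0 ?sqr_ge0 // invr_ge0 ltW.
  by field; rewrite lt0r_neq0.
move: h2; rewrite !big_split sumrN /= -!mulr_sumr -mulr_suml.
by rewrite /m; lra.
Qed.

(** For even p, raising the shift from m0 to m adds a positive multiple of
    x_(k-1)^2, and on vectors with x_(k-1) = 0 the form is that of the leading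
    k-1 rows and columns, which is definite by itself. *)
Lemma pos_def_shifted_gamma m0 m :
  (~~ odd p -> negative_semidefinite (leading_submatrix gamma k - last_diag k m0)) ->
  (odd p -> m = 0) -> (~~ odd p -> m0 < m) -> pos_def k (shifted_gamma m).
Proof.
move=> h0 hodd heven; case: (boolP (odd p)) => po.
  have kp : (k + k <= p.+1)%N by rewrite hkp; lia.
  move=> x hx; have := pos_def_gamma kp hx.
  congr (_ < _); apply: eq_bigr => i _; apply: eq_bigr => j _.
  by rewrite /shifted_gamma hodd // if_same add0r.
move=> x [i ik xi].
set n := k.-1; have kn : k = n.+1 by rewrite /n hkp.
have e : gram_form k (shifted_gamma m) (@scalar_ip R) x =
    gram_form k (shifted_gamma m0) (@scalar_ip R) x + (m - m0) * x n ^+ 2.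
  by rewrite !(gram_form_shifted_recr _ _ (scalar_semi_inner R)) -/n /scalar_ip; ring.
rewrite e; have [xn0|xn] := eqVneq (x n) 0; last first.
  apply: ltr_wpDl; first exact: (nsd_form _).1 (h0 po) x.
  by rewrite mulr_gt0 ?subr_gt0 ?heven // exprn_even_gt0.
rewrite (gram_form_shifted_recr _ _ (scalar_semi_inner R)) -/n xn0 expr0n mulr0 addr0.
rewrite big1 => [|a _]; last by rewrite /scalar_ip !mulr0.
rewrite {2}/scalar_ip !mulr0 subr0 addr0.
apply: pos_def_gamma; first by move: kn; rewrite hkp; lia.
exists i => //; move: ik; rewrite kn ltnS leq_eqVlt => /orP[/eqP ei|//].
by rewrite ei xn0 eqxx in xi.
Qed.

End EnergyCoefficients.

(** * Words in Z and its transpose *)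

Section Orders.
Variable R : realType.

(** A word is a list of letters, true for Z^T and false for Z, read as a
    composition: the head of the list is applied last. *)
Definition word_op (V : lmodType R) (Z Zt : V -> V) (w : seq bool) (u : V) : V :=
  foldr (fun b v => if b then Zt v else Z v) u w.

Definition word_sum (l : seq (R * seq bool)) : method R :=
  fun V Z Zt u => \sum_(cw <- l) cw.1 *: word_op Z Zt cw.2 u.

(** The combination of words is chosen once for all spaces and operators, which
    makes every constant extracted from it uniform. *)
Definition has_order (n : nat) (F : method R) : Prop :=
  exists2 l, all (fun cw : R * seq bool => n <= size cw.2)%N l &
    forall (V : normedModType R) (Z Zt : {linear V -> V}) u,
      F V Z Zt u = word_sum l Z Zt u.

Lemma word_op_cat (V : lmodType R) (Z Zt : V -> V) w1 w2 u :
  word_op Z Zt (w1 ++ w2) u = word_op Z Zt w1 (word_op Z Zt w2 u).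
Proof. exact: foldr_cat. Qed.

Lemma word_op_lin (V : lmodType R) (Z Zt : {linear V -> V}) w a u v :
  word_op Z Zt w (a *: u + v) = a *: word_op Z Zt w u + word_op Z Zt w v.
Proof. by elim: w => //= b w ->; case: b; rewrite linearP. Qed.

Lemma word_opD (V : lmodType R) (Z Zt : {linear V -> V}) w u v :
  word_op Z Zt w (u + v) = word_op Z Zt w u + word_op Z Zt w v.
Proof. by rewrite -[u]scale1r word_op_lin !scale1r. Qed.

Lemma word_op0 (V : lmodType R) (Z Zt : {linear V -> V}) w :
  word_op Z Zt w 0 = 0.
Proof. by elim: w => //= b w ->; case: b; rewrite linear0. Qed.

Lemma word_opZ (V : lmodType R) (Z Zt : {linear V -> V}) w a u :
  word_op Z Zt w (a *: u) = a *: word_op Z Zt w u.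
Proof. by rewrite -[a *: u]addr0 word_op_lin word_op0 addr0. Qed.

Lemma word_op_sum (V : lmodType R) (Z Zt : {linear V -> V}) w I (r : seq I)
    (f : I -> V) :
  word_op Z Zt w (\sum_(i <- r) f i) = \sum_(i <- r) word_op Z Zt w (f i).
Proof.
exact: (big_morph _ (word_opD Z Zt w) (word_op0 Z Zt w)).
Qed.

Lemma order_ext n (F G : method R) : has_order n F ->
  (forall (V : normedModType R) (Z Zt : {linear V -> V}) u, G V Z Zt u = F V Z Zt u) ->
  has_order n G.
Proof. by move=> [l hl hF] e; exists l => // V Z Zt u; rewrite e hF. Qed.

Lemma order_le m n F : (m <= n)%N -> has_order n F -> has_order m F.
Proof.
move=> mn [l hl hF]; exists l => //.
by apply: sub_all hl => cw; exact: leq_trans.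
Qed.

Lemma order_word n w : (n <= size w)%N ->
  has_order n (fun V Z Zt u => word_op Z Zt w u).
Proof.
move=> hw; exists [:: (1, w)]; first by rewrite /= hw.
by move=> V Z Zt u; rewrite /word_sum big_seq1 scale1r.
Qed.

Lemma order_idmap : has_order 0 (fun V Z Zt u => u).
Proof. exact: (@order_word 0 [::]). Qed.

Lemma order_Z : has_order 1 (fun V Z Zt u => Z u).
Proof. exact: (@order_word 1 [:: false]). Qed.

Lemma order_Zt : has_order 1 (fun V Z Zt u => Zt u).
Proof. exact: (@order_word 1 [:: true]). Qed.

Lemma order0 n : has_order n (fun V Z Zt u => 0).
Proof. by exists [::] => // V Z Zt u; rewrite /word_sum big_nil. Qed.

Lemma orderD n F G : has_order n F -> has_order n G ->
  has_order n (fun V Z Zt u => F V Z Zt u + G V Z Zt u).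
Proof.
move=> [l hl hF] [l' hl' hG]; exists (l ++ l'); first by rewrite all_cat hl.
by move=> V Z Zt u; rewrite hF hG /word_sum big_cat.
Qed.

Lemma order_scale n F a : has_order n F ->
  has_order n (fun V Z Zt u => a *: F V Z Zt u).
Proof.
move=> [l hl hF]; exists [seq (a * cw.1, cw.2) | cw <- l]; first by rewrite all_map.
move=> V Z Zt u; rewrite hF /word_sum big_map scaler_sumr.
by apply: eq_bigr => cw _; rewrite scalerA.
Qed.

Lemma order_sum n m (F : nat -> method R) :
  (forall i, (i < m)%N -> has_order n (F i)) ->
  has_order n (fun V Z Zt u => \sum_(i < m) F i V Z Zt u).
Proof.
elim: m => [|m IH] h.
  by apply: order_ext (order0 n) _ => V Z Zt u; rewrite big_ord0.
apply: order_ext (orderD (IH _) (h m _)) _ => // [i im|V Z Zt u].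
  exact/h/leqW.
by rewrite big_ord_recr.
Qed.

Lemma order_comp m n F G : has_order m F -> has_order n G ->
  has_order (m + n) (fun V Z Zt u => F V Z Zt (G V Z Zt u)).
Proof.
move=> [l hl hF] [l' hl' hG].
exists [seq (a.1 * b.1, a.2 ++ b.2) | a <- l, b <- l'].
  apply/allP => cw /allpairsP [[a b] [/= al bl ->]] /=.
  by rewrite size_cat leq_add // ?(allP hl _ al) ?(allP hl' _ bl).
move=> V Z Zt u; rewrite hF hG /word_sum big_allpairs_dep.
apply: eq_bigr => a _; rewrite word_op_sum scaler_sumr.
by apply: eq_bigr => b _; rewrite word_opZ scalerA word_op_cat.
Qed.

Lemma order_iterZ n : has_order n (fun V Z Zt u => iter n Z u).
Proof.
elim: n => [|n IH]; first exact: order_idmap.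
exact: order_ext (order_comp order_Z IH) _.
Qed.

Lemma order_iterZt n : has_order n (fun V Z Zt u => iter n Zt u).
Proof.
elim: n => [|n IH]; first exact: order_idmap.
exact: order_ext (order_comp order_Zt IH) _.
Qed.

Lemma order_additive n F (V : normedModType R) (Z Zt : {linear V -> V}) u v :
  has_order n F -> F V Z Zt (u + v) = F V Z Zt u + F V Z Zt v.
Proof.
move=> [l _ hF]; rewrite !hF /word_sum -big_split; apply: eq_bigr => cw _.
by rewrite word_opD scalerDr.
Qed.

Definition transpose_word (w : seq bool) : seq bool := rev (map negb w).

Definition adjoint_pair (V : lmodType R) (ip : V -> V -> R) (Z Zt : V -> V) :=
  forall u v, ip (Z u) v = ip u (Zt v).

Lemma word_op_adjoint (V : lmodType R) (ip : V -> V -> R) (Z Zt : V -> V) w u v :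
  semi_inner ip -> adjoint_pair ip Z Zt ->
  ip (word_op Z Zt w u) v = ip u (word_op Z Zt (transpose_word w) v).
Proof.
move=> hip hadj; elim: w v => [//|b w IH] v.
rewrite /transpose_word /= rev_cons -cats1 word_op_cat /=.
by case: b; rewrite /= ?hadj -IH // (siC hip) -hadj (siC hip).
Qed.

(** Reversing the words and exchanging the two letters gives the adjoint. *)
Lemma order_adjoint n F : has_order n F -> exists2 G, has_order n G &
  forall (V : normedModType R) (ip : V -> V -> R) (Z Zt : {linear V -> V}) u v,
  semi_inner ip -> adjoint_pair ip Z Zt -> ip (F V Z Zt u) v = ip u (G V Z Zt v).
Proof.
move=> [l hl hF].
exists (word_sum [seq (cw.1, transpose_word cw.2) | cw <- l]).
  eexists => //; rewrite all_map; apply: sub_all hl => cw /=.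
  by rewrite size_rev size_map.
move=> V ip Z Zt u v hip hadj.
rewrite hF /word_sum big_map (si_suml hip) (si_sumr hip).
apply: eq_bigr => cw _.
by rewrite (siZl hip) (siZr hip) (word_op_adjoint _ _ _ hip hadj).
Qed.

End Orders.

(** * Dissipation controls long words *)

Section Dissipative.
Variable R : realType.

Definition bracket (V : lmodType R) (ip : V -> V -> R) (Z : V -> V) v w : R :=
  - ip (Z v) w - ip v (Z w).

(** The bound on the norm of Z is written e^2, so that the square root of that
    norm, which is the natural size of the errors, is the number e. *)
Record dissipative (e : R) (V : lmodType R) (ip : V -> V -> R)
    (Z Zt : V -> V) : Prop :=
  Dissipative {
    dis_gt0 : 0 < e;
    dis_le1 : e <= 1;
    dis_ip : semi_inner ip;
    dis_adj : adjoint_pair ip Z Zt;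
    dis_le0 : forall v, ip (Z v) v <= 0;
    dis_Z : forall v, ip (Z v) (Z v) <= e ^+ 4 * ip v v;
    dis_Zt : forall v, ip (Zt v) (Zt v) <= e ^+ 4 * ip v v }.

Definition dissipation k (V : lmodType R) (ip : V -> V -> R) (Z : V -> V) u : R :=
  \sum_(i < k) bracket ip Z (iter i Z u) (iter i Z u) + ip (iter k Z u) (iter k Z u).

Section Bounds.
Variables (e : R) (V : lmodType R) (ip : V -> V -> R) (Z Zt : {linear V -> V}).
Hypothesis hD : dissipative e ip Z Zt.
Let hip := dis_ip hD.
Let e0 := dis_gt0 hD.
Local Notation br := (bracket ip Z).

Lemma bracket_semi_inner : semi_inner br.
Proof.
split=> [u v|u v w|a u v|u]; rewrite /bracket.
- by rewrite addrC (siC hip v) (siC hip _ u).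
- by rewrite linearD !(siDl hip); ring.
- by rewrite linearZ !(siZl hip); ring.
- by have := dis_le0 hD u; rewrite (siC hip u); lra.
Qed.

Lemma bracket_le v : br v v <= 2 * e ^+ 2 * ip v v.
Proof.
have e20 : 0 < e ^- 2 by rewrite invr_gt0 exprn_gt0.
have := si_amgm hip (Z v) v e20; rewrite invrK => h.
have h1 : e ^- 2 * ip (Z v) (Z v) <= e ^+ 2 * ip v v.
  by rewrite ler_pdivrMl ?exprn_gt0 // mulrA -exprD (dis_Z hD).
have h2 := ler_norm (- ip (Z v) v); rewrite normrN in h2.
rewrite /bracket (siC hip v); lra.
Qed.

Lemma ip_skew_defect u v : ip (Z u + Zt u) v = - br u v.
Proof.
by rewrite /bracket (siDl hip) (siC hip (Zt u)) -(dis_adj hD) (siC hip (Z v)); ring.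
Qed.

(** With S = - (Z + Z^T), |Sv|^2 = [v, Sv] is bounded by
    e^2 [v, v] + [Sv, Sv] / (4 e^2), and [Sv, Sv] <= 2 e^2 |Sv|^2. *)
Lemma skew_defect_le v : ip (Z v + Zt v) (Z v + Zt v) <= 2 * e ^+ 2 * br v v.
Proof.
set w := Z v + Zt v; rewrite {1}/w ip_skew_defect.
have c0 : 0 < 2 * e ^+ 2 by rewrite mulr_gt0 // exprn_gt0.
have := si_amgm bracket_semi_inner v w c0 => h1.
have h2 : (2 * e ^+ 2)^-1 * br w w <= ip w w.
  by rewrite ler_pdivrMl // bracket_le.
have h3 : ip w w = - br v w by rewrite {1}/w ip_skew_defect.
have h4 := ler_norm (- br v w); rewrite normrN in h4.
lra.
Qed.

Lemma word_op_le w u :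
  ip (word_op Z Zt w u) (word_op Z Zt w u) <= (e ^+ 4) ^+ size w * ip u u.
Proof.
elim: w => [|b w IH]; first by rewrite expr0 mul1r.
rewrite [size _]/= [_ ^+ (size w).+1]exprS -mulrA.
have e40 : 0 <= e ^+ 4 by rewrite exprn_ge0 // ltW.
apply: le_trans (ler_wpM2l e40 IH).
by case: b => /=; [exact: (dis_Zt hD) | exact: (dis_Z hD)].
Qed.

Lemma dissipationS k u : dissipation k.+1 ip Z u = br u u + dissipation k ip Z (Z u).
Proof.
rewrite /dissipation big_ord_recl addrA; congr (_ + _ + _).
  by apply: eq_bigr => i _; rewrite -iterSr.
by rewrite -iterSr.
Qed.

Lemma dissipation_ge0 k u : 0 <= dissipation k ip Z u.
Proof.
rewrite addr_ge0 ?(si_ge0 hip) // sumr_ge0 // => i _.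
exact: si_ge0 bracket_semi_inner _.
Qed.

(** Peel off the letter that is applied first.  A letter Z turns the remaining
    word into a shorter one acting on Z u; a letter Z^T does the same up to the
    defect Z + Z^T, whose contribution is paid for by the term [u, u]. *)
Lemma word_op_dissipation w u :
  ip (word_op Z Zt w u) (word_op Z Zt w u) <=
  4 ^+ size w * dissipation (size w) ip Z u.
Proof.
have e21 : e ^+ 2 <= 1 by apply: exprn_ile1; [exact: ltW | exact: dis_le1 hD].
have e41 : e ^+ 4 <= 1 by apply: exprn_ile1; [exact: ltW | exact: dis_le1 hD].
have e40 : 0 <= e ^+ 4 by rewrite exprn_ge0 // ltW.
elim/last_ind: w u => [|w b IH] u.
  by rewrite /dissipation big_ord0 add0r expr0 mul1r.
rewrite size_rcons dissipationS -cats1 word_op_cat [4 ^+ _.+1]exprS.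
have br0 := si_ge0 bracket_semi_inner u.
have h1 := IH (Z u).
have n1 : 1 <= 4 ^+ size w :> R by rewrite exprn_ege1 // ler1n.
have d0 : 0 <= 4 ^+ size w * dissipation (size w) ip Z (Z u).
  by rewrite mulr_ge0 ?dissipation_ge0 ?exprn_ge0.
have nb : br u u <= 4 ^+ size w * br u u by rewrite ler_peMl.
case: b => /=; last by rewrite mulrDr; lra.
have -> : Zt u = (Z u + Zt u) + (- 1) *: Z u by rewrite scaleN1r addrAC subrr add0r.
rewrite word_opD word_opZ.
apply: le_trans (si_sqrD hip _ _) _.
rewrite (siZl hip) (siZr hip) mulN1r mulN1r opprK.
have h2 := word_op_le w (Z u + Zt u).
have h3 := skew_defect_le u.
have s0 := si_ge0 hip (Z u + Zt u).
have h4 : (e ^+ 4) ^+ size w * ip (Z u + Zt u) (Z u + Zt u) <=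
          ip (Z u + Zt u) (Z u + Zt u).
  by rewrite ler_piMl // exprn_ile1.
have h5 : e ^+ 2 * br u u <= br u u by rewrite ler_piMl.
rewrite -mulrA in h3; rewrite -mulrA mulrDr.
lra.
Qed.

(** The first k letters to act are estimated by the dissipation, the others by the
    operator norm. *)
Lemma word_op_split k a w u : (k + a <= size w)%N ->
  ip (word_op Z Zt w u) (word_op Z Zt w u) <=
  4 ^+ k * (e ^+ 4) ^+ a * dissipation k ip Z u.
Proof.
move=> kw; have e40 : 0 <= e ^+ 4 by rewrite exprn_ge0 // ltW.
have e41 : e ^+ 4 <= 1 by apply: exprn_ile1; [exact: ltW | exact: dis_le1 hD].
pose m := (size w - k)%N.
rewrite -(cat_take_drop m w) word_op_cat.
set v := word_op _ _ (drop _ _) _.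
apply: le_trans (word_op_le _ _) _.
have h := word_op_dissipation (drop m w) u; rewrite -/v in h.
have sd : size (drop m w) = k by rewrite size_drop /m; lia.
have st : size (take m w) = m by rewrite size_take /m; case: ltnP; lia.
rewrite sd in h; rewrite st -mulrA mulrCA.
apply: le_trans (ler_wpM2l (exprn_ge0 _ e40) h) _.
rewrite ler_wpM2r ?mulr_ge0 ?exprn_ge0 ?dissipation_ge0 //.
by rewrite ler_wiXn2l // /m; lia.
Qed.

End Bounds.

Lemma order_dissipation k a F : has_order (k + a) F ->
  exists2 K : R, 0 <= K & forall e (V : normedModType R) ip (Z Zt : {linear V -> V}) u,
    dissipative e ip Z Zt ->
    ip (F V Z Zt u) (F V Z Zt u) <= K * (e ^+ 4) ^+ a * dissipation k ip Z u.
Proof.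
move=> [l hl hF].
suff [K K0 hK] : exists2 K : R, 0 <= K &
    forall e (V : normedModType R) ip (Z Zt : {linear V -> V}) u,
    dissipative e ip Z Zt ->
    ip (word_sum l Z Zt u) (word_sum l Z Zt u) <=
    K * (e ^+ 4) ^+ a * dissipation k ip Z u.
  by exists K => // e V ip Z Zt u hD; rewrite hF; exact: hK.
elim: l hl {hF F} => [|[c w] l IH] /=.
  move=> _; exists 0 => // e V ip Z Zt u hD.
  by rewrite /word_sum big_nil (si0l (dis_ip hD)) !mul0r.
move=> /andP[hw /IH [K K0 hK]].
exists (2 * c ^+ 2 * 4 ^+ k + 2 * K).
  by apply: addr_ge0; apply: mulr_ge0 => //; rewrite ?exprn_ge0 // mulr_ge0 ?sqr_ge0.
move=> e V ip Z Zt u hD; rewrite /word_sum big_cons /=.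
apply: le_trans (si_sqrD (dis_ip hD) _ _) _.
have h1 := hK e V ip Z Zt u hD; rewrite /word_sum in h1.
have h2 := word_op_split hD u hw.
have h3 := ler_wpM2l (sqr_ge0 c) h2.
rewrite (siZl (dis_ip hD)) (siZr (dis_ip hD)) [c * (c * _)]mulrA -expr2.
set D := dissipation _ _ _ _ in h1 h3 *.
have -> : (2 * c ^+ 2 * 4 ^+ k + 2 * K) * (e ^+ 4) ^+ a * D =
  2 * (c ^+ 2 * (4 ^+ k * (e ^+ 4) ^+ a * D)) + 2 * (K * (e ^+ 4) ^+ a * D) by ring.
lra.
Qed.

End Dissipative.

(** * Quadratic forms absorbed by the dissipation *)

Section AbsorbableForms.
Variables (R : realType) (k : nat).

Definition quadratic : Type :=
  forall V : normedModType R, (V -> V -> R) -> (V -> V) -> (V -> V) -> V -> R.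

(** The error terms of the energy balance: they become arbitrarily small
    compared with the dissipation as e tends to 0, uniformly in the space. *)
Definition absorbable (q : quadratic) : Prop :=
  exists2 K : R, 0 <= K &
  forall e (V : normedModType R) ip (Z Zt : {linear V -> V}) u,
    dissipative e ip Z Zt -> `|q V ip Z Zt u| <= K * e * dissipation k ip Z u.

Lemma absorbable_ext (q q' : quadratic) : absorbable q ->
  (forall e (V : normedModType R) ip (Z Zt : {linear V -> V}) u,
    dissipative e ip Z Zt -> q' V ip Z Zt u = q V ip Z Zt u) -> absorbable q'.
Proof.
by move=> [K K0 hK] e; exists K => // e' V ip Z Zt u hD; rewrite (e e') // hK.
Qed.

Lemma absorbable0 : absorbable (fun V ip Z Zt u => 0).
Proof. by exists 0 => // e V ip Z Zt u _; rewrite normr0 !mul0r. Qed.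

Lemma absorbableD (q q' : quadratic) : absorbable q -> absorbable q' ->
  absorbable (fun V ip Z Zt u => q V ip Z Zt u + q' V ip Z Zt u).
Proof.
move=> [K K0 hK] [K' K0' hK']; exists (K + K'); first exact: addr_ge0.
move=> e V ip Z Zt u hD; rewrite mulrDl mulrDl.
by apply: le_trans (ler_normD _ _) _; rewrite lerD ?hK ?hK'.
Qed.

Lemma absorbableM a (q : quadratic) : absorbable q ->
  absorbable (fun V ip Z Zt u => a * q V ip Z Zt u).
Proof.
move=> [K K0 hK]; exists (`|a| * K); first by rewrite mulr_ge0.
by move=> e V ip Z Zt u hD; rewrite normrM -!mulrA ler_wpM2l // mulrA hK.
Qed.

Lemma absorbable_sum n (q : nat -> quadratic) :
  (forall i, (i < n)%N -> absorbable (q i)) ->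
  absorbable (fun V ip Z Zt u => \sum_(i < n) q i V ip Z Zt u).
Proof.
elim: n => [|n IH] h.
  by apply: absorbable_ext absorbable0 _ => e V ip Z Zt u _; rewrite big_ord0.
apply: absorbable_ext (absorbableD (IH _) (h n _)) _ => // [i hi|e V ip Z Zt u _].
  exact/h/leqW.
by rewrite big_ord_recr.
Qed.

Lemma absorbable_split F G : has_order (k + 1) F -> has_order k G ->
  absorbable (fun V ip Z Zt u => ip (F V Z Zt u) (G V Z Zt u)).
Proof.
move=> /order_dissipation [K K0 hK]; rewrite -[k in has_order k _]addn0.
move=> /order_dissipation [K' K0' hK'].
exists (K + K'); first exact: addr_ge0.
move=> e V ip Z Zt u hD; have e0 := dis_gt0 hD; have hip := dis_ip hD.
have e20 : 0 < e ^- 2 by rewrite invr_gt0 exprn_gt0.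
have h := si_amgm hip (F V Z Zt u) (G V Z Zt u) e20; rewrite invrK in h.
have h1 := ler_wpM2l (ltW e20) (hK _ _ _ _ _ u hD).
have h2 := ler_wpM2l (sqr_ge0 e) (hK' _ _ _ _ _ u hD).
have d0 := dissipation_ge0 hD k u.
rewrite expr0 mulr1 in h2; rewrite expr1 in h1.
set D := dissipation _ _ _ _ in h1 h2 d0 *.
have e2 : e ^- 2 * (K * e ^+ 4 * D) = e ^+ 2 * (K * D).
  by field; exact: lt0r_neq0.
rewrite e2 in h1.
have ee : e ^+ 2 * ((K + K') * D) <= e * ((K + K') * D).
  apply: ler_wpM2r.
    by apply: mulr_ge0 => //; exact: addr_ge0.
  by rewrite expr2; apply: ler_piMl; [exact: ltW | exact: dis_le1 hD].
have -> : (K + K') * e * D = e * ((K + K') * D) by ring.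
have := normr_ge0 (ip (F V Z Zt u) (G V Z Zt u)); lra.
Qed.

Lemma transpose_wordK : involutive transpose_word.
Proof.
by move=> w; rewrite /transpose_word map_rev revK mapK //; exact: negbK.
Qed.

(** More than 2k letters can be split so that, after moving part of each word to
    the other side, both sides carry at least k letters and one carries k+1. *)
Lemma absorbable_form H : has_order (k + k).+1 H ->
  absorbable (fun V ip Z Zt u => ip u (H V Z Zt u)).
Proof.
move=> [l hl hH].
suff h : absorbable (fun V ip Z Zt u => ip u (word_sum l Z Zt u)).
  by apply: absorbable_ext h _ => e V ip Z Zt u _; rewrite hH.
elim: l hl {hH H} => [|[c w] l IH] /=.
  move=> _; apply: absorbable_ext absorbable0 _ => e V ip Z Zt u hD.
  by rewrite /word_sum big_nil (si0r (dis_ip hD)).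
move=> /andP[hw /IH {}IH].
pose m := (size w - k)%N.
have st : size (take m w) = m by rewrite size_take /m; case: ltnP; lia.
have h1 : has_order (k + 1) (fun (V : normedModType R) (Z Zt : V -> V) u =>
    word_op Z Zt (transpose_word (take m w)) u).
  by apply: order_word; rewrite size_rev size_map st /m; lia.
have h2 : has_order k (fun (V : normedModType R) (Z Zt : V -> V) u =>
    word_op Z Zt (drop m w) u).
  by apply: order_word; rewrite size_drop /m; lia.
apply: absorbable_ext (absorbableD (absorbableM c (absorbable_split h1 h2)) IH) _.
move=> e V ip Z Zt u hD; have hip := dis_ip hD.
rewrite /word_sum big_cons (siDr hip) (siZr hip); congr (_ * _ + _) => /=.
rewrite (word_op_adjoint _ _ _ hip (dis_adj hD)) transpose_wordK.
by rewrite -word_op_cat cat_take_drop.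
Qed.

Lemma absorbable_pair a b F G : has_order a F -> has_order b G ->
  (k + k < a + b)%N ->
  absorbable (fun V ip Z Zt u => ip (F V Z Zt u) (G V Z Zt u)).
Proof.
move=> /order_adjoint[Ft hFt adj] hG hab.
apply: absorbable_ext (absorbable_form (order_le hab (order_comp hFt hG))) _.
move=> e V ip Z Zt u hD.
by rewrite (adj _ _ _ _ _ _ (dis_ip hD) (dis_adj hD)).
Qed.

(** The bracket gains a factor e on a vector of norm O(E(u)^(1/2)), because
    [x, x] <= 2 e^2 |x|^2; the other argument costs nothing, be it one of the
    terms of the dissipation or already estimated by it. *)
Lemma absorbable_bracket F i : has_order k F ->
  absorbable (fun V ip Z Zt u => bracket ip Z (F V Z Zt u) (iter i Z u)).
Proof.
rewrite -[k in has_order k _]addn0 => /order_dissipation[K K0 hK].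
have [K' K0' hK'] : exists2 K : R, 0 <= K &
   forall e (V : normedModType R) ip (Z Zt : {linear V -> V}) u,
    dissipative e ip Z Zt ->
    bracket ip Z (iter i Z u) (iter i Z u) <= K * dissipation k ip Z u.
  have [ik|ki] := ltnP i k.
    exists 1 => // e V ip Z Zt u hD.
    rewrite mul1r /dissipation (bigD1 (Ordinal ik)) //=.
    rewrite -addrA lerDl addr_ge0 ?(si_ge0 (dis_ip hD)) // sumr_ge0 // => j _.
    exact: si_ge0 (bracket_semi_inner hD) _.
  have := order_le ki (order_iterZ R i); rewrite -[k in has_order k _]addn0.
  move=> /order_dissipation[K1 K10 hK1].
  exists (2 * K1); first by rewrite mulr_ge0.
  move=> e V ip Z Zt u hD; apply: le_trans (bracket_le hD _) _.
  have := hK1 _ _ _ _ _ u hD; rewrite expr0 mulr1 => h.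
  have e21 : e ^+ 2 <= 1.
    by apply: exprn_ile1; [exact: ltW (dis_gt0 hD) | exact: dis_le1 hD].
  have := ler_piMl (si_ge0 (dis_ip hD) (iter i Z u)) e21; lra.
exists (K + K'); first exact: addr_ge0.
move=> e V ip Z Zt u hD; have e0 := dis_gt0 hD; have hip := dis_ip hD.
set x := F V Z Zt u; set y := iter i Z u.
have e10 : 0 < e^-1 by rewrite invr_gt0.
have h := si_amgm (bracket_semi_inner hD) x y e10; rewrite invrK in h.
have h1 := hK _ _ _ _ _ u hD; rewrite expr0 mulr1 -/x in h1.
have h2 := ler_wpM2l (ltW e0) (hK' _ _ _ _ _ u hD).
have h3 := ler_wpM2l (ltW e10) (bracket_le hD x).
have h4 := ler_wpM2l (ltW e0) h1.
set D := dissipation _ _ _ _ in h1 h2 h4 *.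
have h5 : e^-1 * (2 * e ^+ 2 * ip x x) = 2 * (e * ip x x).
  by field; exact: lt0r_neq0.
have Dk := mulr_ge0 (ltW e0) (mulr_ge0 K0' (dissipation_ge0 hD k u)).
rewrite -/D in Dk.
have -> : (K + K') * e * D = e * (K * D) + e * (K' * D) by ring.
rewrite -/y in h2; lra.
Qed.

(** Once e is small enough, the definite leading part dominates all the error
    terms. *)
Lemma absorbable_stable (step : method R) (N : nat -> nat -> R) (b : R) :
  (forall i j, (i < k)%N -> (j < k)%N -> N i j = N j i) -> pos_def k N -> b < 0 ->
  absorbable (fun V ip Z Zt u =>
    ip (step V Z Zt u) (step V Z Zt u) - ip u u -
    (b * ip (iter k Z u) (iter k Z u)
     - gram_form k N (bracket ip Z) (fun i => iter i Z u))) ->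
  exists2 e : R, 0 < e <= 1 &
  forall (V : normedModType R) ip (Z Zt : {linear V -> V}) u,
    dissipative e ip Z Zt -> ip (step V Z Zt u) (step V Z Zt u) <= ip u u.
Proof.
move=> hN hpd b0 [K K0 hK].
have [c c0 hc] := pos_def_coercive hN hpd.
pose d := Num.min c (- b).
have d0 : 0 < d by rewrite lt_min c0 oppr_gt0.
pose e := Num.min 1 (d / (K + 1)).
have K1 : 0 < K + 1 by rewrite ltr_wpDl.
have e0 : 0 < e by rewrite lt_min ltr01 divr_gt0.
exists e => [|V ip Z Zt u hD]; first by rewrite e0 ge_min lexx.
have hip := dis_ip hD.
have h1 := hc V _ (bracket_semi_inner hD) (fun i => iter i Z u).
have h2 := le_trans (ler_norm _) (hK _ _ _ _ _ u hD).
have D0 := dissipation_ge0 hD k u.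
have Ke : K * e <= d.
  have : e * (K + 1) <= d by rewrite -ler_pdivlMr // ge_min lexx orbT.
  by rewrite mulrDr mulr1 mulrC; lra.
have h3 := ler_wpM2r D0 Ke.
have S0 : 0 <= \sum_(i < k) bracket ip Z (iter i Z u) (iter i Z u).
  by apply: sumr_ge0 => i _; exact: si_ge0 (bracket_semi_inner hD) _.
have T0 := si_ge0 hip (iter k Z u).
have dc : d <= c by rewrite ge_min lexx.
have db : d <= - b by rewrite ge_min lexx orbT.
have h4 := ler_wpM2r S0 dc.
have h5 := ler_wpM2r T0 db.
have e3 : d * dissipation k ip Z u =
    d * (\sum_(i < k) bracket ip Z (iter i Z u) (iter i Z u))
    + d * ip (iter k Z u) (iter k Z u) by rewrite /dissipation mulrDr.
cbn beta in h1, h2; rewrite e3 in h3.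
lra.
Qed.

End AbsorbableForms.

(** * Energy balance of the Runge--Kutta step *)

Section PolyOp.
Variables (R : realType).

Lemma poly_op_widen (V : normedModType R) n (P : {poly R}) (Z : V -> V) u :
  (size P <= n)%N -> poly_op P Z u = \sum_(i < n) P`_i *: iter i Z u.
Proof.
move=> Pn; rewrite /poly_op (big_ord_widen n (fun i => P`_i *: iter i Z u)) //.
rewrite [RHS](bigID (fun i : 'I_n => (i < size P)%N)) /= [X in _ = _ + X]big1 ?addr0 //.
by move=> i; rewrite -leqNgt => Pi; rewrite nth_default // scale0r.
Qed.

Lemma order_coef n (c : nat -> R) N : (forall i, (i < n)%N -> c i = 0) ->
  has_order n (fun V Z Zt u => \sum_(i < N) c i *: iter i Z u).
Proof.
move=> h; apply: (order_sum (F := fun i V Z Zt u => c i *: iter i Z u)) => i _.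
have [/h->|ni] := ltnP i n.
  by apply: order_ext (order0 R n) _ => V Z Zt u; rewrite scale0r.
exact: order_scale (order_le ni (order_iterZ R i)).
Qed.

Lemma poly_op_sub n (P : {poly R}) (c : nat -> R) :
  (forall i, (i < n)%N -> P`_i = c i) ->
  has_order n (fun V Z Zt u => poly_op P Z u - \sum_(i < n) c i *: iter i Z u).
Proof.
move=> h; pose N := (size P + n)%N.
apply: order_ext (@order_coef n (fun i => P`_i - (if (i < n)%N then c i else 0)) N _) _.
  by move=> i hi; rewrite hi h // subrr.
move=> V Z Zt u; rewrite (poly_op_widen _ _ (leq_addr n _)) -/N.
rewrite (big_ord_widen N (fun i => c i *: iter i Z u)) ?leq_addl //.
rewrite [X in _ - X]big_mkcond -sumrB; apply: eq_bigr => i _.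
by rewrite scalerBl; case: ifP => // _; rewrite scale0r.
Qed.

Lemma order_poly P : has_order 0 (fun (V : normedModType R) Z Zt u => poly_op P Z u).
Proof.
apply: order_ext (@poly_op_sub 0 P (fun=> 0) _) _ => // V Z Zt u.
by rewrite big_ord0 subr0.
Qed.

End PolyOp.

Section RungeKuttaEnergy.
Variables (R : realType) (s k : nat) (P : {poly R}).
Variables (beta : nat -> R) (gamma : nat -> nat -> R).
Hypothesis hP : rk_polynomial s P.
Hypothesis hE : energy_coefficients s P beta gamma.
Hypothesis hk : leading_index s beta k.

Lemma sum_gamma_shift (g : nat -> nat -> R) :
  \sum_(a < s.+1) \sum_(b < s.+1)
    (if a : nat is a'.+1 then gamma_ext s gamma a' b else 0) * g a b =
  \sum_(i < s) \sum_(j < s) gamma i j * g i.+1 j.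
Proof.
rewrite big_ord_recl /= big1 ?add0r => [|b _]; last by rewrite mul0r.
apply: eq_bigr => i _; rewrite big_ord_recr /= {2}/gamma_ext ltnn andbF mul0r addr0.
by apply: eq_bigr => j _; rewrite /gamma_ext !ltn_ord.
Qed.

(** Replace x^a y^b by <Z^a u, Z^b u> in the polynomial energy identity: the
    factor x + y becomes the opposite of the bracket. *)
Lemma runge_kutta_energy (V : normedModType R) (ip : V -> V -> R) (Z : V -> V) u :
  semi_inner ip ->
  ip (poly_op P Z u) (poly_op P Z u) - ip u u =
  \sum_(i < s.+1) beta_ext s beta i * ip (iter i Z u) (iter i Z u) +
  gram_form s gamma (bracket ip Z) (fun i => iter i Z u).
Proof.
move=> hip; have [sz _ _] := hP.
pose g a b := ip (iter a Z u) (iter b Z u).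
have gC a b : g a b = g b a by exact: siC hip _ _.
pose S1 a b := if a is a'.+1 then gamma_ext s gamma a' b else 0.
pose S2 a b := if b is b'.+1 then gamma_ext s gamma a b' else 0.
have e1 : ip (poly_op P Z u) (poly_op P Z u) - ip u u =
   \sum_(a < s.+1) \sum_(b < s.+1)
     (P`_a * P`_b - ((a == 0 :> nat) && (b == 0 :> nat))%:R) * g a b.
  rewrite /poly_op sz (si_suml hip).
  have -> : ip u u = \sum_(a < s.+1) \sum_(b < s.+1)
      ((a == 0 :> nat) && (b == 0 :> nat))%:R * g a b.
    rewrite !big_ord_recl /= mul1r !big1 ?addr0 // => [a _|a _].
      by rewrite big1 // => b _; rewrite mul0r.
    by rewrite mul0r.
  rewrite -sumrB; apply: eq_bigr => a _.
  rewrite (si_sumr hip) -sumrB; apply: eq_bigr => b _.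
  by rewrite (siZl hip) (siZr hip) /g; ring.
have e2 : \sum_(a < s.+1) \sum_(b < s.+1) S2 a b * g a b =
    \sum_(i < s) \sum_(j < s) gamma i j * g i j.+1.
  rewrite exchange_big /= [RHS]exchange_big /=.
  rewrite big_ord_recl /= big1 ?add0r => [|b _]; last by rewrite mul0r.
  apply: eq_bigr => j _; rewrite big_ord_recr /= {2}/gamma_ext ltnn mul0r addr0.
  by apply: eq_bigr => i _; rewrite /gamma_ext !ltn_ord.
have e3 : gram_form s gamma (bracket ip Z) (fun i => iter i Z u) =
    - (\sum_(a < s.+1) \sum_(b < s.+1) S1 a b * g a b +
       \sum_(a < s.+1) \sum_(b < s.+1) S2 a b * g a b).
  rewrite e2 (sum_gamma_shift g) -big_split -sumrN; apply: eq_bigr => i _ /=.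
  rewrite -big_split -sumrN; apply: eq_bigr => j _ /=.
  by rewrite /bracket /g /=; ring.
rewrite e1 e3 -big_split -sumrB /=; apply: eq_bigr => a _.
rewrite -big_split /= (_ : beta_ext s beta a * _ =
  \sum_(b < s.+1) (if a == b then beta_ext s beta a else 0) * g a b).
  rewrite -sumrB; apply: eq_bigr => b _.
  by rewrite (energy_coef hE) /S1 /S2 -val_eqE /=; ring.
rewrite (bigD1 a) //= eqxx big1 ?addr0 // => b ba.
by rewrite eq_sym (negbTE ba) mul0r.
Qed.

(** The terms beta_i with i > k have 2i > 2k letters, and a bracket with an index
    at least k is an error, so that only the leading coefficients survive. *)
Lemma runge_kutta_balance : absorbable k (fun V ip Z Zt u =>
  ip (poly_op P Z u) (poly_op P Z u) - ip u u -
  (beta k * ip (iter k Z u) (iter k Z u) +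
   gram_form k gamma (bracket ip Z) (fun i => iter i Z u))).
Proof.
have [/andP[k0 ks] _ hb] := hk; have [hg _] := hE.
pose q1 (i : nat) : quadratic R := fun V ip Z Zt u =>
  (if i == k then 0 else beta_ext s beta i) * ip (iter i Z u) (iter i Z u).
pose q2 (i j : nat) : quadratic R := fun V ip Z Zt u =>
  (if (i < k)%N && (j < k)%N then 0 else gamma i j) *
  bracket ip Z (iter i Z u) (iter j Z u).
have n1 i : absorbable k (q1 i).
  rewrite /q1; case: eqP => [_|/eqP ik].
    by apply: absorbable_ext (absorbable0 R k) _ => *; rewrite mul0r.
  have [ki|ki] := ltnP k i.
    apply: absorbableM; apply: (absorbable_pair (order_iterZ R i) (order_iterZ R i)).
    lia.
  apply: absorbable_ext (absorbable0 R k) _ => *.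
  rewrite /beta_ext; case: ifP => h; last by rewrite mul0r.
  by rewrite hb ?mul0r //; lia.
have n2 i j : (i < s)%N -> (j < s)%N -> absorbable k (q2 i j).
  move=> hi hj; rewrite /q2; case: ifPn => h.
    by apply: absorbable_ext (absorbable0 R k) _ => *; rewrite mul0r.
  apply: absorbableM; have [ki|ik] := leqP k i.
    exact: absorbable_bracket (order_le ki (order_iterZ R i)).
  have kj : (k <= j)%N by move: h; rewrite ik /= -leqNgt.
  apply: absorbable_ext (absorbable_bracket i (order_le kj (order_iterZ R j))) _.
  by move=> e V ip Z Zt u hD; rewrite (siC (bracket_semi_inner hD)).
have nn := absorbableD (absorbable_sum (n := s.+1) (fun i _ => n1 i))
  (absorbable_sum (n := s) (fun i hi =>
    absorbable_sum (n := s) (fun j hj => n2 i j hi hj))).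
apply: absorbable_ext nn _ => e V ip Z Zt u hD.
rewrite (runge_kutta_energy _ _ (dis_ip hD)) opprD addrACA.
congr (_ + _).
  rewrite /q1 [in RHS](bigD1 (Ordinal (ks : (k < s.+1)%N))) //= eqxx mul0r add0r.
  rewrite (bigD1 (Ordinal (ks : (k < s.+1)%N))) //= {1}/beta_ext k0 ks /=.
  rewrite addrAC subrr add0r; apply: eq_bigr => i ik; rewrite ifN //.
rewrite /gram_form [X in _ - X](big_ord_widen s (fun i =>
  \sum_(j < k) gamma i j * bracket ip Z (iter i Z u) (iter j Z u))) //.
rewrite [X in _ - X]big_mkcond -sumrB; apply: eq_bigr => i _; rewrite /q2.
case: ifP => _; last by rewrite subr0.
rewrite [X in _ - X](big_ord_widen s (fun j =>
  gamma i j * bracket ip Z (iter i Z u) (iter j Z u))) //.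
rewrite [X in _ - X]big_mkcond -sumrB; apply: eq_bigr => j _ /=.
by case: ifP; rewrite ?subrr ?mul0r ?subr0.
Qed.

End RungeKuttaEnergy.

(** * Energy balance of the corrected steps *)

Section Correction.
Variables (R : realType) (s p k : nat) (P : {poly R}) (mu nu : R).
Hypothesis hP : rk_polynomial s P.
Hypothesis hkp : k = uphalf p.+1.
Hypothesis hmu : odd p -> mu = 0.

Definition mu_word : method R := fun V Z Zt u => iter k.-1 Zt (iter k Z u).
Definition nu_word : method R := fun V Z Zt u => iter k Zt (iter k Z u).
Definition corr_op : method R := fun V Z Zt u => correction k mu nu Z Zt u.

Lemma corr_opE (V : normedModType R) (Z Zt : V -> V) u :
  corr_op Z Zt u = mu *: mu_word Z Zt u + nu *: nu_word Z Zt u.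
Proof. by []. Qed.

Lemma order_mu_word : has_order (k.-1 + k) mu_word.
Proof. exact: order_comp (order_iterZt R _) (order_iterZ R _). Qed.

Lemma order_nu_word : has_order (k + k) nu_word.
Proof. exact: order_comp (order_iterZt R _) (order_iterZ R _). Qed.

(** The words carried by mu have length 2k-1, which is p+1 for even p but only p
    for odd p: the vanishing of mu in the second case restores the count. *)
Lemma order_mu_scaled F n m : has_order n F -> (~~ odd p -> m <= n)%N ->
  has_order m (fun V Z Zt u => mu *: F V Z Zt u).
Proof.
move=> hF hm; case: (boolP (odd p)) => [/hmu ->|/hm mn].
  by apply: order_ext (order0 R m) _ => V Z Zt u; rewrite scale0r.
exact: order_scale (order_le mn hF).
Qed.

Lemma order_corr_op : has_order p.+1 corr_op.
Proof.
apply: (orderD (order_mu_scaled order_mu_word _)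
  (order_scale nu (order_le _ order_nu_word))).
- by move=> po; rewrite hkp; lia.
- by rewrite hkp; lia.
Qed.

Lemma adjoint_iter (V : lmodType R) (ip : V -> V -> R) (Z Zt : V -> V) n u v :
  adjoint_pair ip Z Zt -> ip u (iter n Zt v) = ip (iter n Z u) v.
Proof. by move=> adj; elim: n v => [//|n IH] v; rewrite iterSr IH /= adj. Qed.

Lemma corr_op_energy e (V : normedModType R) ip (Z Zt : {linear V -> V}) u :
  dissipative e ip Z Zt ->
  2 * ip u (corr_op Z Zt u) =
  - mu * bracket ip Z (iter k.-1 Z u) (iter k.-1 Z u) +
  2 * nu * ip (iter k Z u) (iter k Z u).
Proof.
move=> hD; have hip := dis_ip hD.
rewrite corr_opE /mu_word /nu_word (siDr hip) !(siZr hip).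
rewrite !(adjoint_iter _ _ _ (dis_adj hD)) /bracket.
have -> : Z (iter k.-1 Z u) = iter k Z u by rewrite hkp.
by rewrite (siC hip (iter k.-1 Z u)); ring.
Qed.

(** Moving Z^T across turns both terms into products of Z^k u with Z^k u and of
    Z^(k-1) u with Z^(k+1) u, which cancel up to the bracket. *)
Lemma mu_word_cross e (V : normedModType R) ip (Z Zt : {linear V -> V}) u :
  dissipative e ip Z Zt ->
  ip (Z u) (mu_word Z Zt u) + ip u (mu_word Z Zt (Z u)) =
  - bracket ip Z (iter k.-1 Z u) (iter k Z u).
Proof.
move=> hD; have hip := dis_ip hD.
rewrite /mu_word !(adjoint_iter _ _ _ (dis_adj hD)) /bracket.
by rewrite -iterSr -[iter k Z (Z u)]iterSr /=; ring.
Qed.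

Lemma absorbable_mu_cross : absorbable k (fun V ip Z Zt u =>
  ip (Z u) (mu_word Z Zt u) + ip u (mu_word Z Zt (Z u))).
Proof.
have h := absorbableM (-1) (absorbable_bracket k.-1 (order_iterZ R k)).
apply: absorbable_ext h _ => e V ip Z Zt u hD.
by rewrite (mu_word_cross u hD) (siC (bracket_semi_inner hD)) mulN1r.
Qed.

Lemma poly_tail2 : has_order 2 (fun V Z Zt u => poly_op P Z u - u - Z u).
Proof.
have [_ P0 P1] := hP.
apply: order_ext (@poly_op_sub R 2 P (fun=> 1) _) _ => [[|[|]]//|V Z Zt u].
by rewrite big_ord_recl big_ord1 /= !scale1r opprD addrA.
Qed.

(** Bookkeeping for a step U + d, where U = u + z + t is the uncorrected step and
    d = c + g + r its increment, sorted by number of letters: in the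
    application z = Z u, c is the correction, g has 2k letters, and the terms
    after the first parenthesis have more than 2k. *)
Lemma increment_expand (V : lmodType R) (ip : V -> V -> R) (u z t c g r U d : V) :
  semi_inner ip -> U = u + z + t -> d = c + g + r ->
  ip (U + d) (U + d) - ip U U - 2 * ip u c =
  2 * (ip z c + ip u g) +
  (2 * ip u r + (2 * ip z (g + r) + (2 * ip t d + ip d d))).
Proof.
move=> hip eU ed.
have -> : ip (U + d) (U + d) = ip U U + 2 * ip U d + ip d d.
  by rewrite (siDl hip) !(siDr hip) (siC hip d U); ring.
have -> : ip U d = ip u d + ip z d + ip t d by rewrite {1}eU !(siDl hip).
have -> : ip u d = ip u c + ip u g + ip u r by rewrite ed !(siDr hip).
have -> : ip z d = ip z c + ip z g + ip z r by rewrite ed !(siDr hip).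
by rewrite (siDr hip z); ring.
Qed.

Lemma order_perturbed : has_order 1 (fun V Z Zt u => Z u + corr_op Z Zt u).
Proof. exact: orderD (order_Z R) (order_le _ order_corr_op). Qed.

Lemma order_iter n (F : method R) : has_order 1 F ->
  has_order n (fun V Z Zt u => iter n (F V Z Zt) u).
Proof.
move=> hF; elim: n => [|n IH].
  exact: order_ext (order_idmap R) _.
exact: order_ext (order_comp hF IH) _.
Qed.

(** Each of the i other factors of a word contributes at least one letter besides
    those of the correction. *)
Lemma order_iter_perturbed i : has_order (p.+1 + i) (fun V Z Zt u =>
  iter i.+1 (fun v => Z v + corr_op Z Zt v) u - iter i.+1 Z u).
Proof.
elim: i => [|i IH].
  rewrite addn0; apply: order_ext order_corr_op _ => V Z Zt u.
  by rewrite /= addrAC subrr add0r.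
have h1 := order_comp (order_Z R) IH.
have h2 := order_comp order_corr_op (order_iter i.+1 order_perturbed).
apply: order_ext (orderD (order_le _ h1) (order_le _ h2)) _; try lia.
move=> V Z Zt u; rewrite iterS [in RHS]linearB -[iter i.+2 Z u]/(Z (iter i.+1 Z u)).
by rewrite addrAC.
Qed.

Definition modified_increment : method R := fun V Z Zt u =>
  poly_op P (fun v => Z v + corr_op Z Zt v) u - poly_op P Z u.

Lemma modified_incrementE n (V : normedModType R) (Z Zt : V -> V) u :
  (size P <= n.+1)%N -> modified_increment Z Zt u =
  \sum_(i < n) P`_i.+1 *: (iter i.+1 (fun v => Z v + corr_op Z Zt v) u - iter i.+1 Z u).
Proof.
move=> Pn; rewrite /modified_increment !(poly_op_widen _ _ Pn) -sumrB.
rewrite big_ord_recl subrr add0r; apply: eq_bigr => i _.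
by rewrite scalerBr.
Qed.

Lemma order_modified_increment : has_order p.+1 modified_increment.
Proof.
apply: order_ext (order_sum (n := p.+1) (m := size P) (F := fun i V Z Zt u =>
  P`_i.+1 *: (iter i.+1 (fun v => Z v + corr_op Z Zt v) u - iter i.+1 Z u)) _) _.
  by move=> i _; apply/order_scale/(order_le _ (order_iter_perturbed i)); lia.
by move=> V Z Zt u; rewrite (@modified_incrementE (size P)).
Qed.

Hypothesis hp : (1 <= p)%N.

(** Common part of the two methods: the increment is the correction, plus a part
    G with 2k letters, plus longer words.  The only terms of length at most 2k
    beyond the correction itself are the two in the last hypothesis. *)
Lemma corrected_balance D G : has_order p.+1 D -> has_order (k + k) G ->
  has_order (k + k).+1 (fun V Z Zt u => D V Z Zt u - corr_op Z Zt u - G V Z Zt u) ->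
  absorbable k (fun V ip Z Zt u => ip (Z u) (corr_op Z Zt u) + ip u (G V Z Zt u)) ->
  absorbable k (fun V ip Z Zt u =>
    ip (poly_op P Z u + D V Z Zt u) (poly_op P Z u + D V Z Zt u)
    - ip (poly_op P Z u) (poly_op P Z u) - 2 * ip u (corr_op Z Zt u)).
Proof.
move=> hD hG hrem hcross.
set rem : method R := fun V Z Zt u => _ in hrem.
pose r2 : method R := fun V Z Zt u => poly_op P Z u - u - Z u.
have n1 := absorbable_form hrem.
have n2 : absorbable k (fun V ip Z Zt u => ip (Z u) (G V Z Zt u + rem V Z Zt u)).
  apply: (absorbable_pair (order_Z R) (orderD hG (order_le _ hrem))); lia.
have n3 : absorbable k (fun V ip Z Zt u => ip (r2 V Z Zt u) (D V Z Zt u)).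
  by apply: (absorbable_pair poly_tail2 hD); rewrite hkp; lia.
have n4 : absorbable k (fun V ip Z Zt u => ip (D V Z Zt u) (D V Z Zt u)).
  by apply: (absorbable_pair hD hD); rewrite hkp; lia.
have nn := absorbableD (absorbableM 2 hcross) (absorbableD (absorbableM 2 n1)
  (absorbableD (absorbableM 2 n2) (absorbableD (absorbableM 2 n3) n4))).
apply: absorbable_ext nn _ => e V ip Z Zt u hdis; have hip := dis_ip hdis.
set U := poly_op P Z u; set d := D V Z Zt u.
have eU : U = u + Z u + r2 V Z Zt u.
  by rewrite /r2 -/U -addrA [Z u + _]addrC subrK addrC subrK.
have ed : d = corr_op Z Zt u + G V Z Zt u + rem V Z Zt u.
  by rewrite /rem -/d -addrA [G _ _ _ _ + _]addrC subrK addrC subrK.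
exact: increment_expand hip eU ed.
Qed.

(** Here G u is the correction applied to Z u, and the cross terms cancel up to
    the bracket by skew-symmetry of Z. *)
Lemma filtering_balance : absorbable k (fun V ip Z Zt u =>
  ip (filtering_method P k mu nu Z Zt u) (filtering_method P k mu nu Z Zt u)
  - ip (poly_op P Z u) (poly_op P Z u) - 2 * ip u (corr_op Z Zt u)).
Proof.
apply: (@corrected_balance (fun V Z Zt u => corr_op Z Zt (poly_op P Z u))
  (fun V Z Zt u => corr_op Z Zt (Z u))).
- by have := order_comp order_corr_op (order_poly P); rewrite addn0.
- by apply: order_le (order_comp order_corr_op (order_Z R)); rewrite hkp; lia.
- have h := order_comp order_corr_op poly_tail2.
  apply: order_ext (order_le _ h) _ => [|V Z Zt u]; first by rewrite hkp; lia.
  set x := _ - _ - Z u.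
  have -> : poly_op P Z u = u + (Z u + x).
    by rewrite /x [Z u + _]addrC subrK addrC subrK.
  rewrite (order_additive _ _ u _ order_corr_op) (order_additive _ _ (Z u) _ order_corr_op).
  by rewrite [corr_op _ _ u + _]addrC addrK [corr_op _ _ (Z u) + _]addrC addrK.
have n2 : absorbable k (fun V ip Z Zt u => ip (Z u) (nu_word Z Zt u)).
  by apply: (absorbable_pair (order_Z R) order_nu_word); lia.
have n3 : absorbable k (fun V ip Z Zt u => ip u (nu_word Z Zt (Z u))).
  by apply: absorbable_form; apply: order_le (order_comp order_nu_word (order_Z R)); lia.
have nn := absorbableD (absorbableM mu absorbable_mu_cross)
   (absorbableM nu (absorbableD n2 n3)).
apply: absorbable_ext nn _ => e V ip Z Zt u hdis; have hip := dis_ip hdis.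
by rewrite !corr_opE !(siDr hip) !(siZr hip); ring.
Qed.

Hypothesis hord : linear_order P p.

Lemma mu_half : mu * P`_2 = mu / 2.
Proof.
case: (boolP (odd p)) => [/hmu ->|po]; first by rewrite !mul0r.
have [h _] := hord; rewrite h //.
by case: (p) po hp => [|[|]].
Qed.

(** The words of length 2k with a factor mu in the increment are
    alpha_2 mu (Z C1 + C1 Z), with C1 = (Z^T)^(k-1) Z^k.  As
    <u, Z C1 u> = - <Z u, C1 u> - [u, C1 u], the value alpha_2 = 1/2 leaves half
    of the cross terms of the filtering method. *)
Lemma modified_balance : absorbable k (fun V ip Z Zt u =>
  ip (modified_method P k mu nu Z Zt u) (modified_method P k mu nu Z Zt u)
  - ip (poly_op P Z u) (poly_op P Z u) - 2 * ip u (corr_op Z Zt u)).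
Proof.
have [_ _ P1] := hP.
pose G : method R := fun V Z Zt u =>
  mu *: (P`_2 *: (Z (mu_word Z Zt u) + mu_word Z Zt (Z u))).
have hsum (F : method R) n : has_order n F -> has_order n.+1 (fun V Z Zt u =>
    Z (F V Z Zt u) + F V Z Zt (Z u)).
  move=> hF; apply: orderD; first exact: order_comp (order_Z R) hF.
  by rewrite -addn1; exact: order_comp hF (order_Z R).
have hG : has_order (k + k) G.
  apply: order_le (order_scale mu (order_scale _ (hsum _ _ order_mu_word))).
  by rewrite hkp; lia.
have h : absorbable k (fun V ip Z Zt u =>
    ip (poly_op P Z u + modified_increment Z Zt u)
       (poly_op P Z u + modified_increment Z Zt u)
    - ip (poly_op P Z u) (poly_op P Z u) - 2 * ip u (corr_op Z Zt u)).
  apply: corrected_balance order_modified_increment hG _ _.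
    have h1 := order_scale (P`_2) (order_scale nu (hsum _ _ order_nu_word)).
    have h2 := order_scale (P`_2) (order_comp order_corr_op order_corr_op).
    have h3 := order_sum (n := p.+3) (m := size P) (F := fun i V Z Zt u =>
      P`_i.+3 *: (iter i.+3 (fun v => Z v + corr_op Z Zt v) u - iter i.+3 Z u)) _.
    apply: order_ext (orderD (orderD h1 (order_le _ h2)) (order_le _ (h3 _))) _.
    - by rewrite hkp; lia.
    - by rewrite hkp; lia.
    - by move=> i _; apply/order_scale/(order_le _ (order_iter_perturbed i.+2)); lia.
    move=> V Z Zt u; rewrite (@modified_incrementE (size P).+2) ?leqW //.
    (* The powers 1 and 2 of the perturbed operator are explicit; from the power 3
       on, at least two letters besides a correction are present. *)
    rewrite !big_ord_recl P1 scale1r.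
    set S := \sum_(i < _) _; set c := corr_op Z Zt u.
    set A := Z (mu_word Z Zt u) + mu_word Z Zt (Z u).
    set B := Z (nu_word Z Zt u) + nu_word Z Zt (Z u).
    have -> : iter 1 (fun v => Z v + corr_op Z Zt v) u - iter 1 Z u = c.
      by rewrite /= addrC addKr.
    have -> : iter 2 (fun v => Z v + corr_op Z Zt v) u - iter 2 Z u =
        mu *: A + nu *: B + corr_op Z Zt c.
      rewrite /= -/c linearD (order_additive _ _ _ _ order_corr_op).
      rewrite addrAC [Z (Z u) + _]addrC addrK addrA; congr (_ + _).
      rewrite /c !corr_opE linearD !linearZ /A /B !scalerDr.
      by rewrite addrACA.
    rewrite /G -/A; clearbody A B c S; rewrite [c + _]addrC addrK !scalerDr.
    rewrite [P`_2 *: (mu *: A)]scalerA mulrC -scalerA.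
    by apply/eqP; rewrite subr_eq; apply/eqP; rewrite -!addrA addrC -!addrA.
  have n1 : absorbable k (fun V ip Z Zt u => ip (Z u) (nu_word Z Zt u)).
    by apply: (absorbable_pair (order_Z R) order_nu_word); lia.
  have n2 : absorbable k (fun V ip Z Zt u => bracket ip Z (mu_word Z Zt u) (iter 0 Z u)).
    by apply: absorbable_bracket; apply: order_le order_mu_word; lia.
  have nn := absorbableD (absorbableM nu n1) (absorbableD
    (absorbableM (mu / 2) absorbable_mu_cross) (absorbableM (- (mu / 2)) n2)).
  apply: absorbable_ext nn _ => e V ip Z Zt u hdis; have hip := dis_ip hdis.
  rewrite /G scalerA mu_half corr_opE (siZr hip) !(siDr hip) !(siZr hip) /bracket /=.
  by rewrite (siC hip (Z (mu_word Z Zt u))) (siC hip (mu_word Z Zt u)); field.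
apply: absorbable_ext h _ => e V ip Z Zt u hdis.
have -> : modified_method P k mu nu Z Zt u = poly_op P Z u + modified_increment Z Zt u.
  by rewrite /modified_increment addrC subrK.
by [].
Qed.

End Correction.

(** * From energy estimates to strong stability *)

Section Norms.
Variable R : realType.

Lemma dot_semi_inner (V : normedModType R) (ip : {dot V for idfun}) : semi_inner ip.
Proof.
split=> [u v|u v w|a u v|u].
- by rewrite hermC expr0 mul1r.
- exact: linearDl.
- exact: linearZl_LR.
- have [->|u0] := eqVneq u 0; first by rewrite linear0l.
  exact: ltW (neq0_dnorm_gt0 _ u0).
Qed.

Lemma induced_norm_sqr (V : normedModType R) (ip : {dot V for idfun}) v :
  induced_norm ip -> `|v| ^+ 2 = ip v v.
Proof. by move=> ->; rewrite sqr_sqrtr // (si_ge0 (dot_semi_inner ip)). Qed.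

Lemma opnorm_ub (V : normedModType R) (L : {linear V -> V}) v :
  bounded_fun_norm L -> `|v| <= 1 -> `|L v| <= opnorm L.
Proof.
move=> hL v1; apply: sup_upper_bound; last by exists v.
split; first by exists `|L v|; exists v.
by have [M hM] := hL 1; exists M => _ [w /= hw <-]; exact: hM.
Qed.

Lemma opnorm_le (V : normedModType R) (L : {linear V -> V}) v :
  bounded_fun_norm L -> `|L v| <= opnorm L * `|v|.
Proof.
move=> hL; have [->|v0] := eqVneq v 0; first by rewrite linear0 !normr0 mulr0.
have nv : 0 < `|v| by rewrite normr_gt0.
rewrite -ler_pdivrMr //.
have -> : `|L v| / `|v| = `|L (`|v|^-1 *: v)|.
  by rewrite linearZ normrZ normfV normr_id mulrC.
apply: opnorm_ub => //.
by rewrite normrZ normfV normr_id mulVf // normr_eq0.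
Qed.

(** The transpose inherits the bound on Z, since |Z^T w|^2 = <Z Z^T w, w>. *)
Lemma adjoint_sqr_le (V : lmodType R) (ip : V -> V -> R) (Z Zt : V -> V) (c : R) w :
  semi_inner ip -> adjoint_pair ip Z Zt -> 0 < c ->
  (forall v, ip (Z v) (Z v) <= c * ip v v) -> ip (Zt w) (Zt w) <= c * ip w w.
Proof.
move=> hip adj c0 hZ; have c1 : 0 < c^-1 by rewrite invr_gt0.
have := si_amgm hip (Z (Zt w)) w c1; rewrite invrK adj => h.
have h1 := ler_norm (ip (Zt w) (Zt w)).
have h2 : c^-1 * ip (Z (Zt w)) (Z (Zt w)) <= ip (Zt w) (Zt w).
  by rewrite ler_pdivrMl.
lra.
Qed.

Lemma scaled_bounded (V : normedModType R) (L : {linear V -> V}) (tau : R) :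
  bounded_fun_norm L -> bounded_fun_norm (tau \*: L).
Proof.
move=> hL r; have [M hM] := hL r; exists (`|tau| * M) => x xr.
by rewrite /= normrZ ler_wpM2l // hM.
Qed.

Lemma admissible_dissipative (V : normedModType R) (ip : {dot V for idfun})
    (L Lt : {linear V -> V}) (tau e : R) :
  admissible ip L Lt -> 0 < tau -> 0 < e <= 1 -> opnorm (tau \*: L) <= e ^+ 2 ->
  dissipative e ip (tau \*: L) (tau \*: Lt).
Proof.
move=> [hn hb ha hs] t0 /andP[e0 e1] hop.
have hip := dot_semi_inner ip.
have adj : adjoint_pair ip (tau \*: L) (tau \*: Lt).
  by move=> u v; rewrite /= (siZl hip) (siZr hip) ha.
have hZ v : ip ((tau \*: L) v) ((tau \*: L) v) <= e ^+ 4 * ip v v.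
  rewrite -!(induced_norm_sqr _ hn).
  rewrite (_ : e ^+ 4 * _ = (e ^+ 2 * `|v|) ^+ 2); last by ring.
  rewrite ler_sqr ?nnegrE ?mulr_ge0 ?exprn_ge0 ?(ltW e0) //.
  apply: le_trans (opnorm_le v (scaled_bounded tau hb)) _.
  exact: ler_wpM2r.
split=> // [v|v].
  by rewrite /= (siZl hip) mulr_ge0_le0 ?hs // ltW.
by apply: adjoint_sqr_le hip adj _ hZ; rewrite exprn_gt0.
Qed.

Lemma strongly_stable_of_energy (step : method R) (e : R) : 0 < e <= 1 ->
  (forall (V : normedModType R) ip (Z Zt : {linear V -> V}) u,
    dissipative e ip Z Zt -> ip (step V Z Zt u) (step V Z Zt u) <= ip u u) ->
  strongly_stable step.
Proof.
move=> he h; have /andP[e0 _] := he.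
exists (e ^+ 2); first exact: exprn_gt0.
move=> V ip L Lt hadm u0 tau t0 hop; have [hn _ _ _] := hadm.
rewrite -ler_sqr ?nnegrE // !(induced_norm_sqr _ hn).
exact: h (admissible_dissipative hadm t0 he hop).
Qed.

End Norms.

(** * From word counting to accuracy *)

Section Accuracy.
Variable R : realType.

Lemma word_op_scale (V : lmodType R) (L Lt : {linear V -> V}) (tau : R) w u :
  word_op (tau \*: L) (tau \*: Lt) w u = tau ^+ size w *: word_op L Lt w u.
Proof.
elim: w => [|b w IH]; first by rewrite expr0 scale1r.
by rewrite exprS -scalerA; case: b; rewrite /= -/(word_op _ _ _ _) IH linearZ.
Qed.

Lemma iter_scale (V : lmodType R) (L : {linear V -> V}) (tau : R) n u :
  iter n (tau \*: L) u = tau ^+ n *: iter n L u.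
Proof.
elim: n => [|n IH]; first by rewrite expr0 scale1r.
by rewrite /= IH linearZ scalerA -exprS.
Qed.

(** A word in tau L and its transpose is tau to the power of its length times
    the word in L, so the constant is read off at tau = 1. *)
Lemma order_norm_le n F (V : normedModType R) (L Lt : {linear V -> V}) u :
  has_order n F -> exists2 K : R, 0 <= K &
  forall tau : R, 0 < tau <= 1 -> `|F V (tau \*: L) (tau \*: Lt) u| <= K * tau ^+ n.
Proof.
move=> [l hl hF].
exists (\sum_(cw <- l) `|cw.1| * `|word_op L Lt cw.2 u|).
  by apply: sumr_ge0 => cw _; rewrite mulr_ge0.
move=> tau /andP[t0 t1]; rewrite hF /word_sum mulr_suml.
apply: le_trans (ler_norm_sum _ _ _) _.
rewrite !big_seq; apply: ler_sum => cw cwl.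
rewrite word_op_scale !normrZ normrX (gtr0_norm t0) -mulrA ler_wpM2l //.
rewrite mulrC ler_wpM2l // ler_wiXn2l ?(ltW t0) //.
exact: (allP hl).
Qed.

(** For tau <= 1 every term of the tail of the exponential series has a factor
    tau^n, and the rest is dominated by the series of exp(M). *)
Lemma exp_op_tail (W : completeNormedModType R) (V : normedModType R)
    (iota : {linear V -> W}) (L : {linear V -> V}) (M : R) n u :
  (forall v, `|iota v| = `|v|) -> 0 <= M -> (forall v, `|L v| <= M * `|v|) ->
  exists2 K : R, 0 <= K & forall tau : R, 0 < tau <= 1 ->
  `|iota (\sum_(i < n) i`!%:R^-1 *: iter i (tau \*: L) u)
    - exp_op iota (tau \*: L) u| <= K * tau ^+ n.
Proof.
move=> hiota M0 hL.
have hit i : `|iter i L u| <= M ^+ i * `|u|.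
  elim: i => [|i IH]; first by rewrite expr0 mul1r.
  by apply: le_trans (hL _) _; rewrite exprS -mulrA ler_wpM2l.
have ce : cvgn (series (exp_coeff M)) by exact: is_cvg_series_exp_coeff.
have e0 i : 0 <= exp_coeff M i by rewrite /exp_coeff /= divr_ge0 ?exprn_ge0.
have K0 : 0 <= expR M * `|u| by rewrite mulr_ge0 // expR_ge0.
exists (expR M * `|u|) => // tau /andP[t0 t1].
pose a i := iota (i`!%:R^-1 *: iter i (tau \*: L) u).
have ha i : `|a i| <= tau ^+ i * exp_coeff M i * `|u|.
  rewrite /a hiota iter_scale !normrZ normfV normrX normr_nat (gtr0_norm t0).
  rewrite /exp_coeff /= mulrCA -!mulrA ler_wpM2l ?exprn_ge0 ?(ltW t0) //.
  by rewrite [leRHS]mulrCA ler_wpM2l ?invr_ge0.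
have ca : cvgn (series a).
  apply: normed_cvg; apply: (@series_le_cvg _ _ (fun i => exp_coeff M i * `|u|)) => //=.
  - by move=> i; rewrite mulr_ge0.
  - move=> i; apply: le_trans (ha i) _; rewrite ler_wpM2r //.
    by rewrite ler_piMl // exprn_ile1 // ltW.
  - have -> : (fun i => exp_coeff M i * `|u|) = `|u| *: exp_coeff M.
      by apply/funext => i; rewrite mulrC.
    exact: is_cvg_seriesZ.
rewrite linear_sum /= distrC leNgt; apply/negP => hlt.
set c := \sum_(i < n) _ in hlt.
have hc : series a m - c @[m --> \oo] --> exp_op iota (tau \*: L) u - c.
  by apply: cvgB => //; exact: cvg_cst.
have := cvgr_norm_gt _ hc _ hlt.
case => N _ /(_ (n + N)%N (leq_addl _ _)) /=.
apply/negP; rewrite -leNgt.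
have -> : series a (n + N)%N - c = \sum_(n <= i < n + N) a i.
  rewrite /series /= (big_cat_nat (n := n)) ?leq_addr //=.
  rewrite big_mkord.
  by rewrite (_ : c = \sum_(i < n) a i) // [X in X - _]addrC addrK.
apply: le_trans (ler_norm_sum _ _ _) _.
have -> : expR M * `|u| * tau ^+ n = tau ^+ n * `|u| * expR M by ring.
apply: (@le_trans _ _ (tau ^+ n * `|u| * \sum_(n <= i < n + N) exp_coeff M i)).
  rewrite mulr_sumr; apply: ler_sum_nat => i /andP[ni _].
  apply: le_trans (ha i) _.
  rewrite -mulrA.
  rewrite (_ : tau ^+ n * _ * _ = tau ^+ n * (exp_coeff M i * `|u|)); last by ring.
  apply: ler_wpM2r; first by rewrite mulr_ge0.
  by rewrite ler_wiXn2l // ltW.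
rewrite ler_wpM2l ?mulr_ge0 ?exprn_ge0 ?(ltW t0) //.
have h1 : series (exp_coeff M) (n + N)%N <= expR M.
  apply: nondecreasing_cvgn_le => //.
  by apply: nondecreasing_series => i _ _; exact: e0.
apply: le_trans h1; rewrite /series /= [leRHS](big_cat_nat (n := n)) ?leq_addr //=.
by rewrite lerDr sumr_ge0.
Qed.

Lemma accurate_of_order p (step : method R) :
  has_order p.+1 (fun V Z Zt u =>
    step V Z Zt u - \sum_(i < p.+1) i`!%:R^-1 *: iter i Z u) ->
  linearly_accurate p step.
Proof.
move=> hord V ip L Lt [_ hb _ _] W iota hiota u.
have [K K0 hK] := order_norm_le L Lt u hord.
have [|K' K0' hK'] := exp_op_tail p.+1 u hiota _ (fun v => opnorm_le v hb).
  by apply: le_trans (opnorm_ub hb (v := 0) _); rewrite ?normr0.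
apply/eqO_exP; exists (K + K' + 1); first by rewrite ltr_wpDl // addr_ge0.
near=> tau.
have t0 : 0 < tau by near: tau; exact: nbhs_right_gt.
have t1 : tau <= 1 by near: tau; exact: nbhs_right_le.
have ht : 0 < tau <= 1 by rewrite t0.
set T := \sum_(i < p.+1) i`!%:R^-1 *: iter i (tau \*: L) u.
rewrite -[X in iota X - _](subrK T) linearD -addrA.
apply: le_trans (ler_normD _ _) _.
rewrite hiota [`|tau ^+ _|]gtr0_norm ?exprn_gt0 //.
have h1 := hK _ ht; have h2 := hK' _ ht; rewrite -/T in h1 h2.
have tp : 0 <= tau ^+ p.+1 by rewrite exprn_ge0 // ltW.
apply: le_trans (lerD h1 h2) _; rewrite -mulrDl ler_wpM2r // lerDl //.
Unshelve. all: by end_near. Qed.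

End Accuracy.

(** * Stability and accuracy of both methods *)

Section Assembly.
Variables (R : realType) (s p k : nat) (P : {poly R}).
Variables (beta : nat -> R) (gamma : nat -> nat -> R) (mu nu : R).
Hypothesis hP : rk_polynomial s P.
Hypothesis hE : energy_coefficients s P beta gamma.
Hypothesis hk : leading_index s beta k.
Hypothesis hkp : k = uphalf p.+1.

Lemma stable_of_balance (step : method R) :
  pos_def k (shifted_gamma k gamma mu) -> nu < - (beta k / 2) ->
  absorbable k (fun V ip Z Zt u => ip (step V Z Zt u) (step V Z Zt u)
    - ip (poly_op P Z u) (poly_op P Z u) - 2 * ip u (corr_op k mu nu Z Zt u)) ->
  strongly_stable step.
Proof.
move=> hpd hnu hstep.
have b0 : beta k + 2 * nu < 0 by lra.
have bal := absorbableD hstep (runge_kutta_balance hP hE hk).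
have [|e he h] := absorbable_stable (step := step)
  (fun i j => @shifted_gamma_sym _ _ _ _ _ _ hE hk mu i j) hpd b0.
  apply: absorbable_ext bal _ => e V ip Z Zt u hD.
  by rewrite (gram_form_shifted gamma hkp) (corr_op_energy mu nu hkp u hD); ring.
exact: strongly_stable_of_energy he h.
Qed.

Hypothesis hord : linear_order P p.
Hypothesis hmu : odd p -> mu = 0.

Lemma runge_kutta_truncation : has_order p.+1 (fun V Z Zt u =>
  poly_op P Z u - \sum_(i < p.+1) i`!%:R^-1 *: iter i Z u).
Proof.
apply: (@poly_op_sub R p.+1 P (fun i => i`!%:R^-1)) => i hi.
have [h _] := hord; exact: h.
Qed.

Lemma accurate_of_increment (step : method R) :
  has_order p.+1 (fun V Z Zt u => step V Z Zt u - poly_op P Z u) ->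
  linearly_accurate p step.
Proof.
move=> h; apply: accurate_of_order.
apply: order_ext (orderD h runge_kutta_truncation) _ => V Z Zt u.
by rewrite addrA subrK.
Qed.

Lemma modified_accurate : linearly_accurate p (modified_method P k mu nu).
Proof.
apply: accurate_of_increment; exact (order_modified_increment P nu hkp hmu).
Qed.

Lemma filtering_accurate : linearly_accurate p (filtering_method P k mu nu).
Proof.
apply: accurate_of_increment.
have := order_comp (order_corr_op nu hkp hmu) (order_poly P); rewrite addn0 => h.
by apply: order_ext h _ => V Z Zt u; rewrite /filtering_method /= addrC addKr.
Qed.

End Assembly.

Theorem theorem3p1 (R : realType) (s p k : nat) (P : {poly R})
    (beta : nat -> R) (gamma : nat -> nat -> R)
    (hP : rk_polynomial s P) (hp : (1 <= p)%N) (hord : linear_order P p)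
    (hE : energy_coefficients s P beta gamma)
    (hk : leading_index s beta k) (hkp : k = uphalf p.+1) :
  (~~ odd p -> exists mu0 : R,
     negative_semidefinite (leading_submatrix gamma k - last_diag k mu0)) /\
  forall mu0 mu nu : R,
    (~~ odd p ->
     negative_semidefinite (leading_submatrix gamma k - last_diag k mu0)) ->
    nu < - (beta k / 2) ->
    (odd p -> mu = 0) ->
    (~~ odd p -> mu0 < mu) ->
    (linearly_accurate p (modified_method P k mu nu) /\
     strongly_stable (modified_method P k mu nu)) /\
    (linearly_accurate p (filtering_method P k mu nu) /\
     strongly_stable (filtering_method P k mu nu)).
Proof.
split; first exact: exists_nsd_shift hP hE hord hk hkp.
move=> mu0 mu nu hnsd hnu hmu hmu0.
have hpd : pos_def k (shifted_gamma k gamma mu).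
  exact (pos_def_shifted_gamma hP hE hord hk hkp hnsd hmu hmu0).
have stable step :=
  @stable_of_balance R s p k P beta gamma mu nu hP hE hk hkp step hpd hnu.
split; split.
- exact: modified_accurate.
- exact: (stable _ (modified_balance nu hP hkp hmu hp hord)).
- exact: filtering_accurate.
- exact: (stable _ (filtering_balance nu hP hkp hmu hp)).
Qed.
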